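(* Let $\alpha,\beta$ be integers different from $1$ with $v_2(\alpha-1)=v_2(\beta-1)=m\ge 3$, and suppose $v_2(\alpha-\beta)=2m-2$. Then $|G_2|=2^{7m-3}$, the nilpotency class of $G_2$ is $5$, $o(a)=o(b)=2^{3m-1}$ and $o(c)=2^{2m-1}$.
   Context: $G(\alpha,\beta)=\langle A,B\mid A^{[A,B]}=A^{\alpha},\ B^{[B,A]}=B^{\beta}\rangle$ with $[x,y]=x^{-1}y^{-1}xy$, $y^x=x^{-1}yx$, and $C=[A,B]$. The group $G(\alpha,\beta)$ is finite and nilpotent, hence the direct product of its Sylow subgroups; $G_2$ denotes its Sylow $2$-subgroup and $a,b,c$ denote the images of $A,B,C$ under the canonical projection $G(\alpha,\beta)\to G_2$. $v_2$ is the $2$-adic valuation and $o(x)$ the order of $x$. *)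

(* Defs.v *)
From mathcomp Require Import all_boot all_order all_algebra all_fingroup all_solvable.
Set Implicit Arguments. Unset Strict Implicit. Unset Printing Implicit Defensive.
Import GRing.Theory Num.Theory.

Local Open Scope group_scope.

Definition zexpg (gT : finGroupType) (x : gT) (z : int) : gT :=
  match z with
  | Posz n => x ^+ n
  | Negz n => x ^- n.+1
  end.

(* the defining relations of G(alpha,beta):
   x^[x,y] = x^alpha,  y^[y,x] = y^beta
   (MathComp: x ^ y = y^-1 x y, [~ x, y] = x^-1 y^-1 x y, as in the paper) *)
Definition Grel (alpha beta : int) (hT : finGroupType) (x y : hT) : Prop :=
  x ^ [~ x, y] = zexpg x alpha /\ y ^ [~ y, x] = zexpg y beta.

(* (G, A, B) is (a copy of) the finitely presented group
   G(alpha,beta) = < A, B | A^[A,B] = A^alpha, B^[B,A] = B^beta >.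
   Since G(alpha,beta) is finite, it is characterized up to isomorphism
   (preserving the generators) by: it is generated by A, B satisfying the
   relations, and for every finite group and elements x, y satisfying the
   relations there is a homomorphism G -> hT with A |-> x, B |-> y. *)
Definition presents_G (alpha beta : int) (gT : finGroupType)
    (G : {group gT}) (A B : gT) : Prop :=
  [/\ G :=: <<[set A; B]>>,
      Grel alpha beta A B &
      forall (hT : finGroupType) (x y : hT), Grel alpha beta x y ->
        exists f : {morphism G >-> hT}, f A = x /\ f B = y].

Definition v2 (z : int) : nat := logn 2 `|z|%N.

(* Main.v *)
(* Write C = [A, B].  From A^C = A^a and A^B = A C one gets
   (A^n)^B = C^n A^(a + a^2 + ... + a^n), and symmetrically for B.  Hence
   G = <B><C><A> as a set, and a comparison of q-parts shows that every prime
   dividing the order of A (resp. B) divides a - 1 (resp. b - 1); therefore the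
   2-parts of A and B generate the Sylow 2-subgroup of G and satisfy the same
   relations.  There, computing [A^a, B] in two ways expresses C^(a - b) as a
   product of powers of B and A with exponents of valuation 2m - 1; conjugating
   this by C and by A bounds the orders of A, B and C, and |G_2| <= 2^(7m - 3).
   For the lower bound, right multiplication by A, B, C in the normal form
   B^j C^k A^i is written down as permutations of Z^3 modulo a lattice of index
   2^(7m - 3); the only relation which is not immediate, C B = B^b C, is an
   explicit congruence.  The universal property maps G onto this transitive
   group, so all the upper bounds are attained. *)
Require Import Defs.
From mathcomp Require Import all_boot all_order all_algebra all_fingroup all_solvable.
From mathcomp Require Import zify ring.
Import GRing.Theory Num.Theory.
Set Implicit Arguments. Unset Strict Implicit. Unset Printing Implicit Defensive.

(** * Products of powers of the generators *)

Section Products.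

Local Open Scope group_scope.

(** Nilpotency of G is never assumed; the factorisation into cyclic groups, applied to pi-parts and
    to a quotient, replaces it. The integers [alpha], [beta] are traded for naturals [b < a]
    congruent to them modulo a multiple of every element order that occurs. The exponent 7m - 3
    splits as (3m - 1) + (2m - 1) + (2m - 1): the orders of B and C, and the power of A that falls
    into <B><C>. The hypothesis m >= 3 enters as 2m < 3m - 2: correction terms have exponents of
    valuation 3m - 2 and must not disturb leading terms of valuation 2m. The exact valuation 2m - 2
    of a - b acts twice. In the upper bound it makes C^n, for n of valuation 2m - 1, an odd power of
    (C^(a - b))^2. In the model, with K = 2^(2m - 1), it leaves a discrepancy K/2 in the exponent of
    C; hence A^K is identified not with a power of B but with B^(K y0) C^(K/2), where y0 is an odd
    solution of a congruence modulo 2^m. *)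

Definition geo (a n : nat) : nat := (\sum_(i < n) a ^ i)%N.

Lemma geo0 a : geo a 0 = 0. Proof. exact: big_ord0. Qed.

Lemma geoSr a n : geo a n.+1 = (geo a n + a ^ n)%N.
Proof. exact: big_ord_recr. Qed.

Lemma geoS a n : geo a n.+1 = (a * geo a n).+1.
Proof.
rewrite /geo big_ord_recl expn0 add1n big_distrr /=; congr _.+1.
by apply: eq_bigr => i _; rewrite expnS.
Qed.

Lemma geo_predn a n : (a.-1 * geo a n = (a ^ n).-1)%N.
Proof. by rewrite predn_exp. Qed.

Lemma conjX_nat (gT : finGroupType) (x z : gT) a n :
  x ^ z = x ^+ a -> x ^ (z ^+ n) = x ^+ (a ^ n).
Proof.
move=> xz; elim: n => [|n IH]; first by rewrite expg0 conjg1 expn0 expg1.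
by rewrite expgSr conjgM IH conjXg xz -expgM expnS.
Qed.

Lemma mulg_expX (gT : finGroupType) (x z : gT) a n :
  x ^ z = x ^+ a -> (x * z) ^+ n = z ^+ n * x ^+ (a * geo a n).
Proof.
move=> xz; elim: n => [|n IH]; first by rewrite geo0 muln0 !expg0 mulg1.
rewrite expgSr IH mulgA -[z ^+ n * _ * x]mulgA -expgSr -mulgA [_ * z]conjgC conjXg xz.
by rewrite -expgM mulgA -expgSr geoS.
Qed.

Section Macdonald.

Variables (gT : finGroupType) (A B C : gT) (a : nat).
Hypotheses (AC : A ^ C = A ^+ a) (AB : A ^ B = A * C).
Hypothesis (nBC : C \in 'N(<[B]>)).

Lemma conjXB n : (A ^+ n) ^ B = C ^+ n * A ^+ (a * geo a n).
Proof. by rewrite conjXg AB (mulg_expX _ AC). Qed.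

Lemma comm_gen : C \in <<[set A; B]>>.
Proof.
have [Ag Bg] : A \in <<[set A; B]>> /\ B \in <<[set A; B]>>.
  by rewrite !mem_gen // !inE eqxx ?orbT.
by rewrite -(groupMl _ Ag) -AB groupJ.
Qed.

(* [A ^ t * B = B * C ^ t * A ^ (a * geo a t)], so the product set on the right
   is stable under right multiplication by [A] and [B]. *)
Lemma gen2_prod : <<[set A; B]>> = (<[B]> <*> <[C]>) * <[A]>.
Proof.
have [Ag Bg] : A \in <<[set A; B]>> /\ B \in <<[set A; B]>>.
  by rewrite !mem_gen // !inE eqxx ?orbT.
apply/eqP; rewrite eqEsubset; apply/andP; split; last first.
  by rewrite mul_subG // ?join_subG ?cycle_subG ?Ag ?Bg ?comm_gen.
set H := <[B]> <*> <[C]>.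
have HB : B \in H by rewrite mem_gen // inE cycle_id.
have HC : C \in H by rewrite mem_gen // inE cycle_id orbT.
have step x : x \in H * <[A]> -> x * A \in H * <[A]> /\ x * B \in H * <[A]>.
  case/mulsgP => h _ Hh /cycleP[n ->] ->; split.
    by rewrite -mulgA -expgSr mem_mulg ?mem_cycle.
  rewrite -mulgA [A ^+ n * _]conjgC conjXB !mulgA.
  by rewrite mem_mulg ?mem_cycle // !groupM ?groupX.
apply/subsetP => x /gen_prodgP [n [c Ac ->]].
elim: n c Ac => [|n IH] c Ac; first by rewrite big_ord0 -[1]mulg1 mem_mulg.
rewrite big_ord_recr /=.
have /step[sA sB] := IH (fun i => c (widen_ord (leqnSn n) i)) (fun i => Ac _).
by have := Ac ord_max; rewrite !inE => /orP[] /eqP->.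
Qed.

Lemma gen2_pgroup pi : pi.-elt A -> pi.-elt B -> pi.-elt C ->
  pi.-group <<[set A; B]>>.
Proof.
move=> piA piB piC; rewrite gen2_prod pgroupM /= norm_joinEr ?cycle_subG //.
by rewrite pgroupM; apply/andP; split=> //; apply/andP.
Qed.

End Macdonald.

End Products.

(** * Primes dividing the orders of the generators *)

Section PrimeDivisors.

Local Open Scope group_scope.

(** Strip one prime [p] of [n] at a time: with [c = b ^ (n / p)], congruent to 1 modulo [p], the
    cofactor [1 + c + ... + c ^ (p - 1)] of [c - 1] in [c ^ p - 1] is a sum of [p] terms congruent
    to 1. *)
Lemma expn_eq1_mod (b d n : nat) : 0 < b -> 0 < n -> d %| b.-1 ->
  (forall p, prime p -> p %| n -> p %| b.-1) -> (d * n)%N %| (b ^ n).-1.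
Proof.
move=> b0; elim/ltn_ind: n => n IH n0 db pb.
have [->|n1] := eqVneq n 1%N; first by rewrite muln1 expn1.
have {n1} n1 : (1 < n)%N by case: n n0 n1 {IH pb} => [|[]].
have pn := pdiv_prime n1; set p := pdiv n in pn.
have /dvdnP[k Dn] : p %| n by apply: pdiv_dvd.
have k0 : (0 < k)%N by case: k Dn n0 => // ->.
have kn : (k < n)%N by rewrite Dn ltn_Pmulr // prime_gt1.
have kpb r : prime r -> r %| k -> r %| b.-1.
  by move=> pr rk; apply: pb => //; rewrite Dn dvdn_mulr.
have := IH k kn k0 db kpb; set c := (b ^ k)%N => dc.
have c0 : (0 < c)%N by rewrite expn_gt0 b0.
have pc : p %| c.-1.
  apply: dvdn_trans (pb p pn (pdiv_dvd n)) _.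
  by rewrite /c predn_exp dvdn_mulr.
rewrite Dn expnM -/c predn_exp mulnA dvdn_mul //.
have c1 : c = 1 %[mod p].
  by rewrite -(prednK c0) -addn1 -modnDml (eqP pc).
rewrite /dvdn -modn_summ; apply/eqP.
under eq_bigr => i _ do rewrite -modnXm c1 modnXm exp1n.
by rewrite modn_summ sum1_card card_ord modnn.
Qed.

Lemma prime_dvd_fact q n : prime q -> (q %| n`!) = (q <= n)%N.
Proof.
move=> pq; apply/idP/idP => [|qn]; last by rewrite dvdn_fact // prime_gt0.
elim: n => [|n IH]; first by rewrite dvdn1 => /eqP q1; rewrite q1 in pq.
rewrite factS Euclid_dvdM // => /orP[/dvdn_leq -> //|/IH /leqW //].
Qed.

Lemma p_elt_expg_in (gT : finGroupType) (q n : nat) (K : {group gT}) (x : gT) :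
  prime q -> q.-elt x -> ~~ (q %| n) -> x ^+ n \in K -> x \in K.
Proof.
move=> pq qx qn Kx.
have cop : coprime #[x] n.
  by apply: pnat_coprime qx _; rewrite p'natE //; case: n qn Kx.
have : generator <[x]> (x ^+ n) by rewrite generator_coprime.
by rewrite /generator => /eqP E; rewrite -cycle_subG E cycle_subG.
Qed.

Section Primes.

Variables (gT : finGroupType) (A B C : gT) (a : nat).
Hypotheses (a_gt0 : (0 < a)%N) (AC : A ^ C = A ^+ a) (AB : A ^ B = A * C).
Hypothesis (nBC : C \in 'N(<[B]>)).

Lemma coprime_order_exp : coprime #[A] a.
Proof.
have := orderJ A C; rewrite AC orderXgcd => E.
have := divnK (dvdn_gcdl #[A] a); rewrite E -[in RHS](muln1 #[A]) => /eqP.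
by rewrite eqn_pmul2l.
Qed.

(* Downward induction on [q].  If [q] does not divide [a - 1], there is an
   exponent [i] with [C ^ i] a [q]-element, [A ^ (a ^ i) = A], but [X], the
   [q]-part of [A ^ i], nontrivial.  The [q]-part of [(A ^ i) ^ B] shows that
   [X ^ B = C ^ i]; comparing [X ^ C = X ^ a] modulo [<[B]>] gives
   [C ^ i \in <[B]>], whence [X = C ^ i] and [X ^ (a - 1) = 1]. *)
Lemma prime_order_dvd q : prime q -> q %| #[A] -> q %| a.-1.
Proof.
have [n] := ubnP (#[A] - q)%N; elim: n q => // n IH q; rewrite ltnS => qn pq qA.
apply: contraT => qa; set N := #[A] in qn qA.
have N0 : (0 < N)%N := order_gt0 A.
have qN : (q * (N %/ q))%N = N by rewrite mulnC divnK.
have Nq0 : (0 < N %/ q)%N by rewrite divn_gt0 ?prime_gt0 // dvdn_leq.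
(* This exponent makes [b] congruent to 1 modulo every prime [p] dividing [N]: by Fermat if
   [p <= q], since [p - 1] divides [(q - 1)!], and by the induction hypothesis if [p > q]. *)
set b := (a ^ q.-1`!)%N.
have b0 : (0 < b)%N by rewrite expn_gt0 a_gt0.
have pb p : prime p -> p %| N -> p %| b.-1.
  move=> pp pN; have [pq'|qp] := leqP p q.
    have p1 := prime_gt1 pp.
    have /dvdnP[k Dk] : (p.-1 %| q.-1`!)%N.
      by apply: dvdn_fact; rewrite -ltnS prednK ?(ltnW p1) // p1 -!subn1 leq_sub2r.
    have cap : coprime a p by rewrite coprime_sym (coprime_dvdl pN) ?coprime_order_exp.
    rewrite /b Dk mulnC expnM -subn1 -eqn_mod_dvd ?expn_gt0 ?a_gt0 //.
    by rewrite -modnXm -(totient_prime pp) Euler_exp_totient // modnXm exp1n.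
  apply: dvdn_trans (IH p _ pp pN) _; last by rewrite /b predn_exp dvdn_mulr.
  by apply: leq_trans qn; apply: ltn_sub2l => //; apply: leq_trans qp (dvdn_leq _ pN).
have aN k : N %| (a ^ (k * (q.-1`! * (N %/ q)))).-1.
  rewrite mulnC expnM expnM -/b predn_exp dvdn_mulr // -{1}qN.
  apply: expn_eq1_mod => // [|p pp pN]; first exact: pb.
  by apply: pb => //; rewrite -qN dvdn_mull.
(* The q'-part of the order of C makes [C ^ i] a q-element. As [w] is prime to [q], the q-part of
   [i] is exactly one factor [q] short of that of [N], so [A ^ i] keeps a nontrivial q-part. *)
set w := (#[C]`_q^' * q.-1`!)%N; set i := (w * (N %/ q))%N.
have qw : coprime q w.
  rewrite coprimeMr (pnat_coprime (pnat_id pq) (part_pnat _ _)) /=.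
  by rewrite prime_coprime // prime_dvd_fact // -ltnNge prednK ?prime_gt0.
have aiN : N %| (a ^ i).-1 by rewrite /i -mulnA aN.
set D := C ^+ i; set X := (A ^+ i).`_q.
have qD : q.-elt D.
  by rewrite p_elt_exp /i /w -mulnA dvdn_mulr.
have AD : A ^ D = A.
  rewrite /D (conjX_nat _ AC) -[RHS]expg1; apply/eqP; rewrite eq_expg_mod_order.
  by rewrite eqn_mod_dvd ?expn_gt0 ?a_gt0 // subn1.
set E := A ^+ (a * geo a i).
have q'E : q^'.-elt E.
  have : E ^+ a.-1 = 1.
    rewrite /E -expgM mulnC mulnCA geo_predn; apply/eqP.
    by rewrite -order_dvdn dvdn_mull.
  move/eqP; rewrite -order_dvdn => Ea; apply/pnatP => // p pp /dvdn_trans/(_ Ea) pa.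
  by rewrite inE /=; apply: contraNneq qa => <-.
have cDE : commute D E.
  by apply: commuteX; apply: commute_sym; apply/commgP/conjg_fixP.
have XB : X ^ B = D.
  rewrite /X -consttJ (conjXB AC AB) -/D -/E (consttM _ cDE).
  by rewrite (constt_p_elt qD) (constt1P q'E) mulg1.
have qX : q.-elt X by apply: p_elt_constt.
have XC : X ^ C = X ^+ a.
  have /cycleP[k Dk] : X \in <[A ^+ i]> by apply: cycle_constt.
  by rewrite Dk !conjXg AC -!expgM mulnC mulnA.
have X1 : X != 1.
  rewrite /X consttX -order_dvdn order_constt p_part Gauss_dvdr ?coprimeXl //.
  rewrite pfactor_dvdn // -ltnNge -/N -{2}qN lognM ?(prime_gt0 pq) //.
  by rewrite (logn_prime q pq) eqxx.
have nD : D \in 'N(<[B]>) by apply: groupX.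
have nB : B \in 'N(<[B]>) by rewrite (subsetP (normG _)) ?cycle_id.
have XD : X = D ^ B^-1 by rewrite -XB conjgK.
have DB : D \in <[B]>.
  apply: (p_elt_expg_in pq qD qa); apply: coset_idr; first exact: groupX.
  have DX : coset <[B]> D = coset <[B]> X.
    by rewrite XD morphJ ?groupV //= [coset _ B^-1]coset_id ?conjg1 ?groupV ?cycle_id.
  have nX : X \in 'N(<[B]>) by rewrite XD groupJ ?groupV.
  have : coset <[B]> X ^ coset <[B]> C = coset <[B]> X ^+ a.
    by rewrite -morphJ // -morphX //= XC.
  rewrite -DX -morphJ // conjXg [C ^ C]/conjg mulKg -{1}(prednK a_gt0) expgS => eX.
  have mX := morphX (coset_morphism <[B]>) a.-1 nD.
  apply: (mulgI (coset <[B]> D)); rewrite mulg1 [coset _ (D ^+ _)]mX; exact: esym eX.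
have eXD : X = D.
  rewrite XD; apply/conjg_fixP/commgP; apply: commuteV.
  by have /cycleP[k ->] := DB; apply/commute_sym/commuteX.
case/negP: X1; suff: X \in [1 gT] by rewrite inE.
apply: (p_elt_expg_in pq qX qa); rewrite inE.
have : X ^ C = X by rewrite eXD conjXg [C ^ C]/conjg mulKg.
rewrite XC -{1}(prednK a_gt0) expgS => eX.
by apply/eqP/(mulgI X); rewrite mulg1.
Qed.
End Primes.

End PrimeDivisors.

(** * Primary parts *)

Section PrimaryParts.

Local Open Scope group_scope.

Lemma constt_comm (gT : finGroupType) (pi rho : nat_pred) (x : gT) :
  commute x.`_pi x.`_rho.
Proof. by apply: (centsP (cycle_abelian x)); apply: cycle_constt. Qed.

Section Parts.

Variables (gT : finGroupType) (A B C : gT) (a : nat).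
Hypotheses (a_gt0 : (0 < a)%N) (AC : A ^ C = A ^+ a) (AB : A ^ B = A * C).
Hypothesis (nBC : C \in 'N(<[B]>)).

(** Let [N] be the order of the pi'-part of A. Its primes divide [a - 1], so [a ^ N] is 1 modulo [N]
    and [C ^ N] centralises that part. Since [N] is a pi'-number, the pi-part of C is a power of its
    own [N]-th power. *)
Lemma constt_commute (pi : nat_pred) : commute A.`_pi^' C.`_pi.
Proof.
set N := (#[A]`_pi^')%N.
have Adv : N %| (a ^ N).-1.
  have := @expn_eq1_mod a 1 N a_gt0 (part_gt0 _ _) (dvd1n _); rewrite mul1n; apply.
  move=> p pp pN; apply: (prime_order_dvd a_gt0 AC AB nBC pp).
  by rewrite (dvdn_trans pN) ?dvdn_part.
have cN : A.`_pi^' ^ (C ^+ N) = A.`_pi^'.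
  have /cycleP[k Dk] := cycle_constt pi^' A.
  have AC' : A.`_pi^' ^ C = A.`_pi^' ^+ a by rewrite Dk conjXg AC -!expgM mulnC.
  rewrite (conjX_nat _ AC') -[RHS]expg1; apply/eqP.
  by rewrite eq_expg_mod_order order_constt eqn_mod_dvd ?expn_gt0 ?a_gt0 // subn1.
have : C.`_pi \in <[C.`_pi ^+ N]>.
  have : generator <[C.`_pi]> (C.`_pi ^+ N).
    by rewrite generator_coprime order_constt coprime_partC.
  by rewrite /generator => /eqP<-; apply: cycle_id.
case/cycleP=> k ->; apply: commuteX.
have /cycleP[l ->] := cycle_constt pi C; rewrite -expgM mulnC expgM.
by apply: commuteX; apply/commgP/conjg_fixP.
Qed.

Lemma constt_commuteC (pi : nat_pred) : commute A.`_pi C.`_pi^'.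
Proof.
rewrite -(eq_constt _ (negnK pi : pi^'^' =i pi)).
exact: constt_commute.
Qed.

Lemma constt_norm (pi : nat_pred) : A.`_pi ^ C.`_pi = A.`_pi ^+ a.
Proof.
have AC' : A.`_pi ^ C = A.`_pi ^+ a.
  by have /cycleP[k ->] := cycle_constt pi A; rewrite conjXg AC -!expgM mulnC.
rewrite -AC' -{2}(consttC pi C) constt_comm conjgM; congr (_ ^ _).
by apply/esym/conjg_fixP/commgP/constt_commuteC.
Qed.

(** By the commutation of mixed parts, [A * C] is the product of [A.]_pi * C.[_pi] and its
    pi'-analogue; these commute and are a pi-element and a pi'-element, so the pi-part of [A ^ B]
    can be read off. *)
Lemma constt_conj (pi : nat_pred) : A.`_pi ^ B = A.`_pi * C.`_pi.
Proof.
have piAC (p : nat_pred) : p.-elt (A.`_p * C.`_p).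
  have -> : A.`_p * C.`_p = (C.`_p * A.`_p) ^ (A.`_p)^-1.
    by rewrite conjgE invgK -!mulgA mulgV mulg1.
  rewrite p_eltJ; apply: p_eltM_norm; try exact: p_elt_constt.
  by rewrite -cycle_subG norms_cycle constt_norm mem_cycle.
have E : A * C = (A.`_pi * C.`_pi) * (A.`_pi^' * C.`_pi^').
  rewrite -{1}(consttC pi A) -{1}(consttC pi C) -!mulgA; congr (_ * _).
  by rewrite !mulgA (constt_commute pi).
have cE : commute (A.`_pi * C.`_pi) (A.`_pi^' * C.`_pi^').
  apply: commuteM; apply: commute_sym; apply: commuteM; apply: commute_sym.
  - exact: constt_comm.
  - exact/commute_sym/constt_commute.
  - exact: constt_commuteC.
  - exact: constt_comm.
rewrite -consttJ AB E consttM // (constt_p_elt (piAC pi)).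
by rewrite (constt1P (piAC pi^')) mulg1.
Qed.

End Parts.

Lemma conj_commg (gT : finGroupType) (A B : gT) : A ^ B = A * [~ A, B].
Proof. by rewrite conjg_mulR. Qed.

Lemma norm_commg (gT : finGroupType) (A B : gT) (b : nat) :
  B ^ [~ B, A] = B ^+ b -> [~ A, B] \in 'N(<[B]>).
Proof.
by move=> rB; rewrite -groupV invg_comm -cycle_subG norms_cycle rB mem_cycle.
Qed.

Section Sylow.

Variables (gT : finGroupType) (A B : gT) (a b : nat) (pi : nat_pred).
Hypotheses (a_gt0 : (0 < a)%N) (b_gt0 : (0 < b)%N).
Hypotheses (rA : A ^ [~ A, B] = A ^+ a) (rB : B ^ [~ B, A] = B ^+ b).

Let C := [~ A, B].

Lemma parts_conjl : A.`_pi ^ B = A.`_pi * C.`_pi.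
Proof. exact: constt_conj a_gt0 rA (conj_commg A B) (norm_commg rB) pi. Qed.

Lemma parts_conjr : B.`_pi ^ A = B.`_pi * (C.`_pi)^-1.
Proof.
rewrite (constt_conj b_gt0 rB (conj_commg B A) (norm_commg rA)).
by rewrite -invg_comm consttV.
Qed.

(** [parts_conjr] says that [[~ A, B.]_pi] = C.[_pi]; taking the pi-part of [A ^ B.]_pi = A *
    C.[_pi] then replaces A by its pi-part. *)
Lemma parts_comm : [~ A.`_pi, B.`_pi] = C.`_pi.
Proof.
have AB : A ^ B.`_pi = A * C.`_pi.
  have := parts_conjr; rewrite conjg_mulR => /mulgI/(congr1 invg).
  by rewrite invg_comm invgK conjg_mulR => ->.
apply: (mulgI A.`_pi); rewrite -conjg_mulR -consttJ AB.
have piAC : pi.-elt (A.`_pi * C.`_pi) by rewrite -parts_conjl p_eltJ p_elt_constt.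
have cAC := constt_commute a_gt0 rA (conj_commg A B) (norm_commg rB) pi.
rewrite -{1}(consttC pi A) -mulgA cAC mulgA consttM.
  by rewrite (constt_p_elt piAC) (constt1P (p_elt_constt _ _)) mulg1.
by apply: commute_sym; apply: commuteM => //; apply: constt_comm.
Qed.

Lemma parts_rel : A.`_pi ^ [~ A.`_pi, B.`_pi] = A.`_pi ^+ a /\
  B.`_pi ^ [~ B.`_pi, A.`_pi] = B.`_pi ^+ b.
Proof.
split.
  by rewrite parts_comm; apply: constt_norm a_gt0 rA (conj_commg A B) (norm_commg rB) pi.
have := constt_norm b_gt0 rB (conj_commg B A) (norm_commg rA) pi.
by rewrite -invg_comm consttV -parts_comm invg_comm.
Qed.

(** Conjugation by A and B keeps the generators inside P. In the quotient by P the images of A, B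
    and C are pi'-elements satisfying the same relations, so [gen2_pgroup] applies a second time, to
    pi', and bounds the index. *)
Lemma parts_Hall : <<[set A.`_pi; B.`_pi]>> <| <<[set A; B]>> /\
  pi.-Hall(<<[set A; B]>>) <<[set A.`_pi; B.`_pi]>>.
Proof.
set P := <<[set A.`_pi; B.`_pi]>>; set G := <<[set A; B]>>.
have [Ag Bg] : A \in G /\ B \in G by rewrite !mem_gen // !inE eqxx ?orbT.
have [Ap Bp] : A.`_pi \in P /\ B.`_pi \in P by rewrite !mem_gen // !inE eqxx ?orbT.
have [rA' rB'] := parts_rel.
have Cp : C.`_pi \in P by rewrite -parts_comm groupR.
have Gp x : x \in G -> x.`_pi \in G.
  by move=> xG; apply: (subsetP _ _ (cycle_constt pi x)); rewrite cycle_subG.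
have nP : P <| G.
  apply/andP; split; first by rewrite gen_subG subUset !sub1set !Gp.
  rewrite gen_subG subUset !sub1set !inE -!genJ !gen_subG.
  apply/andP; split; apply/subsetP => _ /imsetP[x xS ->];
    move: xS; rewrite !inE => /orP[] /eqP->.
  - by rewrite -consttJ conjgE mulKg.
  - by rewrite parts_conjr groupM ?groupV.
  - by rewrite parts_conjl groupM ?groupV.
  - by rewrite -consttJ conjgE mulKg.
have piP : pi.-group P.
  apply: (gen2_pgroup rA' (conj_commg _ _) (norm_commg rB')); rewrite ?parts_comm; apply: p_elt_constt.
split=> //; rewrite /pHall (normal_sub nP) piP -card_quotient ?normal_norm //=.
have nS : [set A; B] \subset 'N(P) by rewrite (subset_trans _ (normal_norm nP)) // subset_gen.
have [nA nB] : A \in 'N(P) /\ B \in 'N(P) by move: nS; rewrite subUset !sub1set => /andP[].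
have cosp x : x \in G -> x.`_pi \in P -> pi^'.-elt (coset P x).
  move=> xG xP; have xN : {in G, forall y, y \in 'N(P)} by apply/subsetP/normal_norm.
  rewrite -(consttC pi x) morphM ?xN ?Gp //=; last first.
    by apply: (subsetP _ _ (cycle_constt _ x)); rewrite cycle_subG.
  rewrite coset_id // mul1g morph_p_elt ?p_elt_constt //.
  by apply/xN/(subsetP _ _ (cycle_constt _ x)); rewrite cycle_subG.
rewrite quotient_gen // quotientU !quotient_set1 //.
apply: (@gen2_pgroup _ _ _ (coset P C) a).
- by rewrite -morphJ ?groupR // rA morphX.
- by rewrite -morphJ // conjg_mulR morphM ?groupR.
- have -> : coset P C = [~ coset P A, coset P B] by rewrite -morphR.
  by apply: (@norm_commg _ _ _ b); rewrite -morphR // -morphJ ?groupR // rB morphX.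
- exact: cosp.
- exact: cosp.
- by apply: cosp; rewrite // groupR.
Qed.

End Sylow.

End PrimaryParts.

(** * 2-adic valuations of iterated geometric sums *)

Section Valuations.

Local Open Scope nat_scope.

Lemma logn_addl x y : 0 < x -> logn 2 x < logn 2 y ->
  logn 2 (x + y) = logn 2 x.
Proof.
move=> x0 lt; have xy0 : 0 < x + y by rewrite addn_gt0 x0.
apply/eqP; rewrite eqn_leq; apply/andP; split; last first.
  rewrite -pfactor_dvdn // dvdn_add ?pfactor_dvdnn //.
  by rewrite (dvdn_trans _ (pfactor_dvdnn 2 y)) // dvdn_exp2l // ltnW.
rewrite leqNgt -pfactor_dvdn // dvdn_addl; last first.
  by rewrite (dvdn_trans _ (pfactor_dvdnn 2 y)) // dvdn_exp2l.
by rewrite pfactor_dvdn // ltnn.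
Qed.

Lemma geoD a i j : geo a (i + j) = geo a i + a ^ i * geo a j.
Proof.
elim: j => [|j IH]; first by rewrite geo0 muln0 !addn0.
by rewrite addnS !geoSr IH mulnDr expnD addnA.
Qed.

(** The second-order sum measuring how far [a * geo a n] is from [n]: the difference is
    [(a - 1) * sgeo a n], by [geo_sgeo]. *)
Definition sgeo (a n : nat) : nat := \sum_(i < n) geo a i.+1.

Lemma sgeoS a n : sgeo a n.+1 = sgeo a n + geo a n.+1.
Proof. exact: big_ord_recr. Qed.

Lemma sgeo0 a : sgeo a 0 = 0. Proof. exact: big_ord0. Qed.

Lemma sgeoD a k n : sgeo a (k + n) = sgeo a k + a ^ k * sgeo a n + n * geo a k.
Proof.
elim: n => [|n IH]; first by rewrite sgeo0 muln0 mul0n !addn0.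
rewrite addnS !sgeoS IH -addnS geoD; lia.
Qed.

Lemma geo_sgeo a n : 0 < a -> a * geo a n = n + a.-1 * sgeo a n.
Proof.
move=> a0; elim: n => [|n IH]; first by rewrite geo0 sgeo0 !muln0.
rewrite geoS mulnS IH sgeoS geoS IH; case: a a0 IH => // a _ _; rewrite /=; lia.
Qed.

Lemma logn_subl x y : 0 < x -> 0 < y -> logn 2 y < logn 2 (x + y) ->
  logn 2 x = logn 2 y.
Proof.
move=> x0 y0; case: (ltngtP (logn 2 x) (logn 2 y)) => // lt.
  by rewrite logn_addl //; lia.
by rewrite addnC logn_addl //; lia.
Qed.

(** Subtraction-free form of [a ^ a - geo a a = (a - 1) ^ 2 * geo a (a - 1) - (a - 1) * sgeo a (a -
    2)]. In [logn_fund] the two terms on the right have valuations 3m and 2m - 1, which decides the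
    left side. *)
Lemma geo_fund a : 1 < a ->
  a ^ a + a.-1 * sgeo a a.-2 = geo a a + a.-1 ^ 2 * geo a a.-1.
Proof.
case: a => [|[|n]] // _; set a := n.+2.
have E1 : a ^ a = 1 + n.+1 * geo a a.
  have a0 : 0 < a ^ a by rewrite expn_gt0.
  by have := geo_predn a a; rewrite /= ; lia.
have E2 : geo a a = 1 + a * geo a n.+1 by rewrite {2}/a geoS.
have E3 := @geo_sgeo a n.+1 isT; rewrite sgeoS in E3.
rewrite E1 E2 /=; set g := geo a n.+1 in E2 E3 *; set t := sgeo a n in E3 *.
rewrite /a /= in E3 *.
have Eg : g = n.+1 + n.+1 * t by lia.
rewrite Eg; nia.
Qed.

Section Valuation.
Variable a : nat.
Hypothesis (a0 : 0 < a) (a4 : 4 %| a.-1).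

Lemma odd_base : odd a. Proof. by lia. Qed.

Lemma logn_expS1 k : logn 2 (1 + a ^ k) = 1.
Proof.
have : (1 + a ^ k) %% 4 = 2.
  rewrite -modnDmr -modnXm; have -> : a %% 4 = 1 by lia.
  by rewrite exp1n.
move=> E; apply/eqP; rewrite eqn_leq; apply/andP; split.
  by rewrite leqNgt -(@pfactor_dvdn 2 2) ?add1n //; lia.
by rewrite -(@pfactor_dvdn 2 1) ?add1n //; lia.
Qed.

Lemma odd_geo n : odd (geo a n) = odd n.
Proof.
elim: n => [|n IH]; first by rewrite geo0.
by rewrite geoS /= oddM odd_base IH.
Qed.

Lemma logn_odd n : odd n -> logn 2 n = 0.
Proof. by move=> on; rewrite lognE dvdn2 on /= andbF. Qed.

Lemma geo_gt0 n : 0 < n -> 0 < geo a n.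
Proof. by case: n => // n _; rewrite geoS. Qed.

(** Halving: [geo a (2 k) = (1 + a ^ k) * geo a k], and [1 + a ^ k] is 2 modulo 4. *)
Lemma logn_geo n : 0 < n -> logn 2 (geo a n) = logn 2 n.
Proof.
elim/ltn_ind: n => n IH n0; have [on|en] := boolP (odd n).
  by rewrite !logn_odd ?odd_geo.
have [k Dn] : exists k, n = k + k by exists n./2; lia.
have k0 : 0 < k by lia.
have -> : geo a n = (1 + a ^ k) * geo a k by rewrite Dn geoD mulnDl mul1n.
have -> : n = 2 * k by lia.
by rewrite !lognM ?geo_gt0 // logn_expS1 IH //; lia.
Qed.

Lemma logn_predX n : 0 < n -> 1 < a -> logn 2 (a ^ n).-1 = logn 2 a.-1 + logn 2 n.
Proof.
move=> n0 a1; rewrite predn_exp lognM ?logn_geo //; last exact: geo_gt0.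
by lia.
Qed.

Lemma sgeo_gt0 n : 0 < n -> 0 < sgeo a n.
Proof. by case: n => // n _; rewrite sgeoS geoS; lia. Qed.

(** Halving: [sgeo a (2 k) = (1 + a ^ k) * sgeo a k + k * geo a k]. For odd [k] the first term is
    even and the second odd; for even [k] the first has the valuation of [k] by induction and the
    second twice that. *)
Lemma logn_sgeo n : 0 < n -> ~~ odd n -> (logn 2 (sgeo a n)).+1 = logn 2 n.
Proof.
elim/ltn_ind: n => n IH n0 en.
have [k Dn] : exists k, n = k + k by exists n./2; lia.
have k0 : 0 < k by lia.
have -> : sgeo a n = (1 + a ^ k) * sgeo a k + k * geo a k.
  by rewrite Dn sgeoD mulnDl mul1n.
have -> : logn 2 n = (logn 2 k).+1.
  have -> : n = 2 * k by lia.
  by rewrite lognM //=.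
congr _.+1; have [ok|ek] := boolP (odd k).
  rewrite (logn_odd ok); apply: logn_odd.
  by rewrite oddD !oddM odd_geo ok oddD oddX odd_base /= orbT.
have IHk : (logn 2 (sgeo a k)).+1 = logn 2 k by apply: IH => //; lia.
rewrite logn_addl ?lognM ?sgeo_gt0 ?geo_gt0 // ?logn_expS1 ?muln_gt0 ?sgeo_gt0 //.
rewrite logn_geo //; have : 0 < logn 2 k by rewrite logn_gt0 mem_primes k0 dvdn2.
lia.
Qed.

Lemma logn_fund m : logn 2 a.-1 = m -> 2 <= m ->
  geo a a < a ^ a /\ logn 2 (a ^ a - geo a a) = 2 * m - 1.
Proof.
move=> um m2; have u0 : 0 < a.-1 by rewrite lt0n; apply/eqP => u0; rewrite u0 logn0 in um; lia.
have a1 : 1 < a by lia.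
have E := geo_fund a1.
have lt : geo a a < a ^ a.
  have aa : 0 < a ^ a by rewrite expn_gt0 a0.
  have := geo_predn a a; have := geo_gt0 a0; move: aa.
  case: (a) a1 => [|[|n]] // _; rewrite /= -/(geo _ _).
  move: (geo _ _) (_ ^ _)%N => g x; nia.
split=> //; set x := a ^ a - geo a a.
have Ex : x + a.-1 * sgeo a a.-2 = a.-1 ^ 2 * geo a a.-1 by rewrite /x; lia.
have x0 : 0 < x by rewrite subn_gt0.
have eu : ~~ odd a.-1 by lia.
have Su : sgeo a a.-1 = geo a a.-1 + sgeo a a.-2.
  have E1 : a.-2.+1 = a.-1 by lia.
  by rewrite -E1 sgeoS E1 addnC.
have s0 : 0 < sgeo a a.-2 by apply: sgeo_gt0; lia.
have lg : logn 2 (geo a a.-1) = m by rewrite logn_geo.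
(* [logn_sgeo] needs an even index, so pass through [a - 1]: there the sum has valuation m - 1, and
   the last term, which is removed, has valuation m. *)
have eS : logn 2 (sgeo a a.-2) = m.-1.
  have := logn_sgeo u0 eu; rewrite Su um addnC => lS.
  have [lts|ge] := ltnP (logn 2 (sgeo a a.-2)) m.
    by rewrite logn_addl ?lg // in lS; lia.
  have : 2 ^ m %| sgeo a a.-2 + geo a a.-1.
    by rewrite dvdn_add ?pfactor_dvdn ?geo_gt0 // lg.
  by rewrite pfactor_dvdn ?addn_gt0 ?s0 //; lia.
rewrite (@logn_subl x (a.-1 * sgeo a a.-2)) ?muln_gt0 ?u0 //.
  rewrite lognM // um eS; lia.
rewrite Ex !lognM ?expn_gt0 ?u0 ?geo_gt0 // um lg eS; lia.
Qed.

End Valuation.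

End Valuations.

(** * Relations in the 2-part *)

Section UpperBound.

Local Open Scope group_scope.

(** * Powers of 2-elements *)

Section TwoElements.

Variables (gT : finGroupType) (x : gT).
Hypothesis x2 : 2.-elt x.

(** [r] is the quotient of the odd parts of [n] and [k] modulo the order of [x], the inverse being
    supplied by Euler's theorem. *)
Lemma expg_odd_multiple (n k : nat) : (0 < n)%N -> (0 < k)%N ->
  logn 2 n = logn 2 k -> exists2 r, odd r & x ^+ n = x ^+ (k * r).
Proof.
move=> n0 k0 nk; have [e De] := p_natP x2.
have [n' on Dn] := pfactor_coprime (isT : prime 2) n0.
have [k' ok Dk] := pfactor_coprime (isT : prime 2) k0.
rewrite coprime2n in on; rewrite coprime2n in ok.
exists (n' * k' ^ (totient (2 ^ e)).-1)%N; first by rewrite oddM oddX on ok orbT.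
apply/eqP; rewrite eq_expg_mod_order De Dn nk {2}Dk.
set t := totient _; have t0 : (0 < t)%N by rewrite totient_gt0 expn_gt0.
set q := (2 ^ logn 2 k)%N.
have -> : (k' * q * (n' * k' ^ t.-1) = n' * q * k' ^ t)%N.
  by rewrite -{2}(prednK t0) expnS; nia.
rewrite eq_sym -modnMmr /t Euler_exp_totient ?modnMmr ?muln1 //.
by rewrite coprimeXr // coprimen2.
Qed.

Lemma expg_odd_in (n : nat) (K : {group gT}) : (0 < n)%N -> x ^+ n \in K ->
  x ^+ (2 ^ logn 2 n) \in K.
Proof.
move=> n0 xK.
have [r _ ->] : exists2 r, odd r & x ^+ (2 ^ logn 2 n) = x ^+ (n * r).
  by apply: expg_odd_multiple; rewrite ?expn_gt0 ?pfactorK.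
by rewrite expgM groupX.
Qed.

Lemma expg_odd_eq1 (n j : nat) : (0 < n)%N -> x ^+ n = 1 -> (logn 2 n <= j)%N ->
  x ^+ (2 ^ j) = 1.
Proof.
move=> n0 xn nj; have := @expg_odd_in n [1 gT] n0.
rewrite !inE xn eqxx => /(_ isT)/eqP E.
by rewrite -(subnK nj) expnD mulnC expgM E expg1n.
Qed.

End TwoElements.

Lemma expg_involution (gT : finGroupType) (x : gT) r : x ^+ 2 = 1 -> odd r -> x ^+ r = x.
Proof.
by move=> x2 r1; rewrite -(odd_double_half r) r1 -mul2n expgD expgM x2 expg1n mulg1.
Qed.

Lemma expg_last_layer (gT : finGroupType) (x : gT) j k : 2.-elt x ->
  (x ^+ (2 ^ j)) ^+ 2 = 1 -> (0 < k)%N -> logn 2 k = j -> x ^+ k = x ^+ (2 ^ j).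
Proof.
move=> x2 xj k0 lk.
have [r r1 ->] : exists2 r, odd r & x ^+ k = x ^+ (2 ^ j * r).
  by apply: expg_odd_multiple => //; rewrite ?expn_gt0 // lk pfactorK.
by rewrite expgM; apply: expg_involution.
Qed.

Lemma dvdn2_expg1 (gT : finGroupType) (x : gT) j n :
  x ^+ (2 ^ j) = 1 -> (j <= logn 2 n)%N -> x ^+ n = 1.
Proof.
move=> xj jn; have [->|n0] := posnP n; first by rewrite expg0.
by move: jn; rewrite -pfactor_dvdn // => /dvdnP[k ->]; rewrite mulnC expgM xj expg1n.
Qed.

Lemma conjg_fix_expg (gT : finGroupType) (x c : gT) a :
  (0 < a)%N -> x ^ c = x ^+ a -> commute x c -> x ^+ a.-1 = 1.
Proof.
move=> a0 xc cx; apply: (mulgI x); rewrite mulg1 -expgS prednK // -xc.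
exact/conjg_fixP/commgP.
Qed.

Lemma conjX_rel (gT : finGroupType) (x c : gT) a k :
  x ^ c = x ^+ a -> (x ^+ k) ^ c = (x ^+ k) ^+ a.
Proof. by rewrite conjXg => ->; rewrite -!expgM mulnC. Qed.

Lemma logn22 : logn 2 2 = 1%N. Proof. by []. Qed.

Lemma commute_middle (gT : finGroupType) (x y z t : gT) :
  commute x y -> commute x z -> x * (y * (z * t)) = y * z * (x * t).
Proof. by move=> xy xz; rewrite !mulgA xy -(mulgA y x) xz !mulgA. Qed.

Section Upper.

Variables (gT : finGroupType) (A B : gT) (a b m : nat).
Hypotheses (rA : A ^ [~ A, B] = A ^+ a) (rB : B ^ [~ B, A] = B ^+ b).
Hypotheses (m3 : (3 <= m)%N) (b0 : (0 < b)%N) (ba : (b < a)%N).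
Hypotheses (ua : logn 2 a.-1 = m) (ub : logn 2 b.-1 = m).
Hypothesis (ud : logn 2 (a - b) = (2 * m - 2)%N).
Hypothesis P2 : 2.-group <<[set A; B]>>.

Let C := [~ A, B].
Let a0 : (0 < a)%N. Proof. by apply: leq_ltn_trans ba. Qed.

Lemma dvd4_pred c : logn 2 c.-1 = m -> 4 %| c.-1.
Proof.
move=> uc; have [->|c0] := posnP c.-1; first by rewrite dvdn0.
by rewrite (@pfactor_dvdn 2 2) // uc ltnW.
Qed.

Lemma gt1_pred c : logn 2 c.-1 = m -> (1 < c)%N.
Proof. by case: c => [|[|c]] //=; rewrite logn0 => E; move: m3; rewrite -E. Qed.

Let a1 := gt1_pred ua. Let b1 := gt1_pred ub.
Let au0 : (0 < a.-1)%N. Proof. by rewrite -subn1 subn_gt0. Qed.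
Let bu0 : (0 < b.-1)%N. Proof. by rewrite -subn1 subn_gt0. Qed.
Let a4 := dvd4_pred ua. Let b4 := dvd4_pred ub.

Let AP : A \in <<[set A; B]>>. Proof. by rewrite mem_gen // !inE eqxx. Qed.
Let BP : B \in <<[set A; B]>>. Proof. by rewrite mem_gen // !inE eqxx orbT. Qed.
Let CP : C \in <<[set A; B]>>. Proof. by rewrite groupR. Qed.
Let A2 : 2.-elt A. Proof. exact: mem_p_elt P2 AP. Qed.
Let B2 : 2.-elt B. Proof. exact: mem_p_elt P2 BP. Qed.
Let C2 : 2.-elt C. Proof. exact: mem_p_elt P2 CP. Qed.

Let rB' : B ^ C^-1 = B ^+ b. Proof. by rewrite invg_comm. Qed.
Let AB : A ^ B = A * C. Proof. exact: conj_commg. Qed.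
Let BA : B ^ A = B * C^-1. Proof. by rewrite invg_comm conj_commg. Qed.
Let ABn n : (A ^+ n) ^ B = C ^+ n * A ^+ (a * geo a n).
Proof. exact: conjXB rA AB n. Qed.
Let BAn n : (B ^+ n) ^ A = C ^- n * B ^+ (b * geo b n).
Proof. by rewrite (conjXB rB' BA) expgVn. Qed.
Let ACn n : A ^ (C ^+ n) = A ^+ (a ^ n). Proof. exact: conjX_nat. Qed.
Let BCn n : B ^ (C ^- n) = B ^+ (b ^ n).
Proof. by rewrite -expgVn; apply: conjX_nat. Qed.

(* Compute [[~ A ^ a, B]] in two ways, using [A ^ a = A ^ C]. *)
Lemma fundamental_rel :
  C ^+ a * A ^- (a * (a ^ a - geo a a)) = B ^+ (b ^ b - geo b b) * C ^+ b.
Proof.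
have [ltA _] := logn_fund a0 a4 ua (ltnW m3).
have [ltB _] := logn_fund b0 b4 ub (ltnW m3).
have BAa : B ^ (A ^+ a) = C ^- b * B ^+ geo b b.
  have BC : (B ^+ b) ^ C = B by rewrite -rB' conjgKV.
  rewrite -rA -{1}(conjgKV C B) -conjJg rB' BAn conjMg conjVg conjXg.
  by rewrite [C ^ C]conjgE mulKg expgM conjXg BC.
have key : C ^+ a * A ^+ (a * geo a a) = A ^+ a * (B ^- geo b b * (C ^+ b * B)).
  rewrite -ABn; apply: (mulgI (A ^- a)); rewrite mulKg -commgEl -invg_comm commgEl BAa.
  by rewrite !invMg !invgK mulgA.
have CbB : C ^+ b * B = B ^+ (b ^ b) * C ^+ b.
  by rewrite -BCn conjgE invgK !mulgA mulgKV.
have AaCa : A ^+ a * (C ^+ a * A ^- (a * a ^ a)) = C ^+ a.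
  by rewrite mulgA [A ^+ a * _]conjgC conjXg ACn -expgM -mulgA [(_ * a)%N]mulnC mulgV mulg1.
rewrite -[in RHS](mulKg (B ^+ geo b b) (B ^+ _)) -expgD subnKC; last exact: ltnW.
rewrite -mulgA -CbB; apply: (mulgI (A ^+ a)); rewrite -key.
have -> : (a * (a ^ a - geo a a) = a * a ^ a - a * geo a a)%N by rewrite mulnBr.
have le : (a * geo a a <= a * a ^ a)%N by rewrite leq_mul2l ltnW ?orbT.
have E : A ^- (a * a ^ a - a * geo a a) * A ^- (a * geo a a) = A ^- (a * a ^ a).
  by rewrite -invMg -expgD subnKC.
by apply: (mulIg (A ^- (a * geo a a))); rewrite mulgK -!mulgA E.
Qed.

Let d := (a - b)%N.
Let X := (a * (a ^ a - geo a a))%N.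
Let Y := (b ^ b - geo b b)%N.

Lemma commX_decomp : exists2 n, logn 2 n = (2 * m - 1)%N &
  (0 < n)%N /\ C ^+ d = B ^+ n * A ^+ X.
Proof.
have [ltB lB] := logn_fund b0 b4 ub (ltnW m3).
have Y0 : (0 < Y)%N by rewrite subn_gt0.
have BC k : B ^ (C^-1 ^+ k) = B ^+ (b ^ k) by apply: conjX_nat.
(* Only [C^-1] acts on B by a known power map, so [C ^ b] is rewritten as a natural power of
   [C^-1]. *)
set k := (b * #[C].-1)%N.
have Ck : C ^+ b = C^-1 ^+ k.
  apply: (mulIg (C ^+ k)); rewrite expgVn mulVg -expgD; apply/eqP.
  by rewrite -order_dvdn /k -mulnS prednK ?order_gt0 // dvdn_mull.
have ob : odd (b ^ k) by rewrite oddX odd_base ?orbT.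
exists (b ^ k * Y)%N; first by rewrite lognM ?expn_gt0 ?b0 // (logn_odd ob) lB.
split; first by rewrite muln_gt0 expn_gt0 b0.
have E := fundamental_rel; rewrite -/X -/Y in E.
have Da : C ^+ a = C ^+ b * C ^+ d by rewrite -expgD subnKC // ltnW.
rewrite expgM -BC -Ck -conjXg conjgE -mulgA -E Da -!mulgA mulKg mulVg mulg1.
by [].
Qed.

Lemma logn_X : logn 2 X = (2 * m - 1)%N.
Proof.
have [ltA lA] := logn_fund a0 a4 ua (ltnW m3).
by rewrite lognM ?subn_gt0 // lA logn_odd // odd_base.
Qed.

Lemma logn_aX k : (0 < k)%N -> logn 2 (a ^ k).-1 = (m + logn 2 k)%N.
Proof. by move=> k0; rewrite logn_predX ?ua. Qed.

Lemma logn_bX k : (0 < k)%N -> logn 2 (b ^ k).-1 = (m + logn 2 k)%N.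
Proof. by move=> k0; rewrite logn_predX ?ub. Qed.

Lemma logn_bgeo n : (0 < n)%N -> ~~ odd n ->
  logn 2 (b * geo b n - n) = (m + logn 2 n).-1.
Proof.
move=> n0 en; rewrite (geo_sgeo _ b0) addKn lognM ?sgeo_gt0 //.
by rewrite ub -(logn_sgeo b0 b4 n0 en) addnS.
Qed.

Lemma comm_cyclesI x : x \in <[A]> -> x \in <[B]> ->
  [/\ commute x A, commute x B & commute x C].
Proof.
case/cycleP=> i Di /cycleP[j Dj].
have cA : commute x A by rewrite Di; apply/commute_sym/commuteX.
have cB : commute x B by rewrite Dj; apply/commute_sym/commuteX.
by split=> //; rewrite /C /commg /conjg; do ![apply: commuteM | apply: commuteV].
Qed.

(** The factor 2 keeps the exponent odd and positive even for [x = 1], so that inversion preserves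
    the valuations of exponents. *)
Lemma cycle_invX (x : gT) : x^-1 = x ^+ (2 * #[x]).-1.
Proof.
apply: (mulgI x); rewrite mulgV -expgS prednK ?muln_gt0 ?order_gt0 //.
by rewrite mulnC expgM expg_order expg1n.
Qed.

(* With [C ^ d = q * p], [q \in <[B]>], [p \in <[A]>]: conjugation by [C] makes
   [p ^ (a - 1)] central, so [p] and [q] commute; conjugation by [A] gives a
   second expression for an odd power of [(C ^ d) ^ 2], and comparing both puts
   [A ^ (2 ^ (2 * m))] into [<[B]>]. *)
Lemma upper_relations :
  [/\ A ^+ (2 ^ (3 * m - 1)) = 1, B ^+ (2 ^ (3 * m - 1)) = 1,
      C ^+ (2 ^ (2 * m - 1)) = 1,
      A ^+ (2 ^ (3 * m - 2)) = B ^+ (2 ^ (3 * m - 2)) &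
   [/\ A ^+ (2 ^ (2 * m)) \in <[B]>, B ^+ (2 ^ (2 * m)) \in <[A]> &
       A ^+ (2 ^ (2 * m - 1)) \in <[B]> <*> <[C]>]].
Proof.
have [n ln [n0 DD]] := commX_decomp.
set q := B ^+ n in DD; set p := A ^+ X in DD; set D := C ^+ d in DD.
have d0 : (0 < d)%N by rewrite subn_gt0.
have lX := logn_X.
have X0 : (0 < X)%N by rewrite lt0n; apply/eqP=> X0; move: lX; rewrite X0 logn0; clear -m3; lia.
have en : ~~ odd n by apply/negP => /logn_odd; rewrite ln; clear -m3; lia.
have pC : p ^ C = p ^+ a by rewrite conjXg rA -!expgM mulnC.
have ADX : A ^ D = A ^+ (a ^ d) by apply: ACn.
have nCB : C \in 'N(<[B]>) by apply: norm_commg rB.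
have pA : p \in <[A]> by apply: mem_cycle.
have qB : q \in <[B]> by apply: mem_cycle.
have puB : p ^+ a.-1 \in <[B]>.
  have DC : D ^ C = D by rewrite conjXg [C ^ C]conjgE mulKg.
  have -> : p ^+ a.-1 = (q ^ C)^-1 * q.
    by apply: (mulIg p); rewrite -expgSr prednK // -pC -mulgA -DD -{1}DC DD conjMg mulKg.
  by rewrite groupM ?groupV ?memJ_norm.
have p2m : p ^+ (2 ^ (2 * m)) = 1.
  have [_ _ cC] := comm_cyclesI (groupX _ pA) puB.
  have := conjg_fix_expg a0 (conjX_rel a.-1 pC) cC; rewrite -expgM => E.
  apply: (expg_odd_eq1 _ _ E); first exact: mem_p_elt P2 (groupX _ AP).
    by rewrite muln_gt0 -subn1 subn_gt0 a1.
  by rewrite lognM ?ua -?subn1 ?subn_gt0 //; clear -m3; lia.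
have ldX : logn 2 (a ^ d).-1 = (3 * m - 2)%N by rewrite logn_aX // ud; clear -m3; lia.
set e := A ^+ (a ^ d).-1.
have eA : e \in <[A]> by apply: mem_cycle.
have eE : A^-1 * A ^+ (a ^ d) = e.
  by apply: (mulgI A); rewrite mulKVg -expgS prednK ?expn_gt0 ?a0.
have DA : D ^ A = D * e^-1 by rewrite conjg_mulR -invg_comm commgEl ADX eE.
have cAA x y : x \in <[A]> -> y \in <[A]> -> commute x y.
  by move=> xA yA; apply: (centsP (cycle_abelian A)).
have qA : q ^ A = q * e^-1.
  have ep : e^-1 * p = p * e^-1 by apply: cAA; rewrite ?groupV.
  apply: (mulIg p); rewrite -(mulgA q) ep (mulgA q) -DD -DA DD conjMg.
  by rewrite [p ^ A]conjgE (cAA p A pA (cycle_id A)) mulKg.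
have Aq : A ^ q = A ^ D.
  rewrite conjg_mulR -invg_comm commgEl qA mulKg invgK ADX /e -expgS prednK //.
  by rewrite expn_gt0 a0.
have cpq : commute p q.
  apply/commgP/conjg_fixP; rewrite conjXg Aq ADX -expgM mulnC expgM.
  rewrite -(prednK (_ : 0 < a ^ d)%N) ?expn_gt0 ?a0 // expgS (dvdn2_expg1 p2m) ?mulg1 //.
  by rewrite ldX; clear -m3; lia.
have CnB : C ^- n * B ^+ (b * geo b n) = q * e^-1 by rewrite -BAn -qA.
have [r or Cr] : exists2 r, odd r & C ^+ n = C ^+ (2 * d * r).
  apply: expg_odd_multiple => //; first by rewrite muln_gt0.
  by rewrite lognM // ln ud logn22; clear -m3; lia.
have r0 : (0 < r)%N by case: (r) or.
set h := (b * geo b n)%N in CnB.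
have nh : (n < h)%N.
  by rewrite /h (geo_sgeo _ b0) -[X in (X < _)%N]addn0 ltn_add2l muln_gt0 sgeo_gt0 // -subn1 subn_gt0 b1.
have lh : logn 2 (h - n) = (3 * m - 2)%N by rewrite /h logn_bgeo // ln; clear -m3; lia.
set f := B ^+ (h - n).
have fB : f \in <[B]> by apply: mem_cycle.
have cBB x y : x \in <[B]> -> y \in <[B]> -> commute x y.
  by move=> xB yB; apply: (centsP (cycle_abelian B)).
have hE : B ^+ h = q * f by rewrite /q /f -expgD subnKC // ltnW.
have CnE : C ^+ n = B ^+ h * (q * e^-1)^-1.
  by rewrite -CnB invMg invgK mulKVg.
have CnD : C ^+ n = q ^+ (2 * r) * p ^+ (2 * r).
  by rewrite Cr (mulnC 2 d) -mulnA expgM -/D DD expgMn.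
(* After cancelling [q], the two values of [C ^ n] give [q ^ (2 r) * p ^ (2 r) * e^-1 = f].
   Separating powers of A from powers of B produces an element of both cyclic groups. *)
set z := p ^+ (2 * r) * e^-1.
have zE : z = (q ^+ (2 * r))^-1 * f.
  apply: (mulgI (q ^+ (2 * r))); rewrite mulKVg; apply: (mulgI q); rewrite -hE.
  have -> : B ^+ h = C ^+ n * (q * e^-1) by rewrite CnE mulgKV.
  have c1 : commute q (q ^+ (2 * r)) by apply: commuteX.
  have c2 : commute q (p ^+ (2 * r)) by apply/commuteX/commute_sym.
  by rewrite CnD; apply: commute_middle.
have zA : z \in <[A]> by apply: groupM; [exact: groupX | rewrite groupV].
have zB : z \in <[B]> by rewrite zE; apply: groupM => //; rewrite groupV; exact: groupX.
have invX (x : gT) k : (x ^+ k)^-1 = x ^+ (k * (2 * #[x]).-1).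
  by rewrite -expgVn cycle_invX -expgM mulnC.
have predX_gt0 c k : (1 < c)%N -> (0 < k)%N -> (0 < (c ^ k).-1)%N.
  by move=> c1 k0; rewrite -subn1 subn_gt0 -(expn0 c) ltn_exp2l.
have logn_2r k : (0 < k)%N -> logn 2 k = (2 * m - 1)%N -> logn 2 (k * (2 * r)) = (2 * m)%N.
  move=> k0 lk; rewrite !lognM ?muln_gt0 ?r0 // lk (logn_odd or) logn22; clear -m3; lia.
(* Here m >= 3 is used: [e] and [f] have exponents of valuation 3m - 2 > 2m, so [z] and [z^-1] keep
   exponents of valuation exactly 2m in A and in B. *)
have [s ls Ds] : exists2 s, logn 2 s = (2 * m)%N & z = A ^+ s.
  exists (X * (2 * r) + (a ^ d).-1 * (2 * #[A]).-1)%N; last first.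
    by rewrite expgD expgM -invX.
  have lr := logn_2r X X0 lX.
  have o0 : (0 < (2 * #[A]).-1)%N by case: #[A] (order_gt0 A) => // k _; rewrite mulnS.
  apply: etrans (logn_addl _ _) (lr); first by rewrite muln_gt0 X0 muln_gt0 r0.
  by rewrite lr lognM ?predX_gt0 // ldX; clear -m3; lia.
have [t lt Dt] : exists2 t, logn 2 t = (2 * m)%N & z^-1 = B ^+ t.
  exists (n * (2 * r) + (h - n) * (2 * #[B]).-1)%N; last first.
    have cfq : commute f^-1 (q ^+ (2 * r)) by apply: cBB; [rewrite groupV | exact: groupX].
    by rewrite expgD expgM -invX zE invMg invgK.
  have lr := logn_2r n n0 ln.
  have o0 : (0 < (2 * #[B]).-1)%N by case: #[B] (order_gt0 B) => // k _; rewrite mulnS.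
  apply: etrans (logn_addl _ _) (lr); first by rewrite muln_gt0 n0 muln_gt0 r0.
  by rewrite lr lognM ?subn_gt0 // lh; clear -m3; lia.
have s0 : (0 < s)%N by rewrite lt0n; apply: contra_eqN ls => /eqP->; rewrite logn0; clear -m3; lia.
have t0 : (0 < t)%N by rewrite lt0n; apply: contra_eqN lt => /eqP->; rewrite logn0; clear -m3; lia.
have AB2 : A ^+ (2 ^ (2 * m)) \in <[B]> by rewrite -ls expg_odd_in // -Ds.
have BA2 : B ^+ (2 ^ (2 * m)) \in <[A]> by rewrite -lt expg_odd_in // -Dt groupV.
have A3 : A ^+ (2 ^ (3 * m)) = 1.
  have [_ _ cC] := comm_cyclesI (mem_cycle _ _) AB2.
  have := conjg_fix_expg a0 (conjX_rel _ rA) cC; rewrite -expgM => E.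
  apply: (expg_odd_eq1 A2 _ E); first by rewrite muln_gt0 expn_gt0 au0.
  by rewrite lognM ?expn_gt0 ?au0 // pfactorK // ua; clear -m3; lia.
have B3 : B ^+ (2 ^ (3 * m)) = 1.
  have [_ _ cC] := comm_cyclesI BA2 (mem_cycle _ _).
  have := conjg_fix_expg b0 (conjX_rel _ rB') (commuteV cC); rewrite -expgM => E.
  apply: (expg_odd_eq1 B2 _ E); first by rewrite muln_gt0 expn_gt0 bu0.
  by rewrite lognM ?expn_gt0 ?bu0 // pfactorK // ub; clear -m3; lia.
have eB : e \in <[B]>.
  have : 2 ^ (2 * m) %| (a ^ d).-1 by rewrite pfactor_dvdn ?predX_gt0 // ldX; clear -m3; lia.
  by rewrite /e => /dvdnP[k ->]; rewrite mulnC expgM groupX.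
have fA : f \in <[A]>.
  have : 2 ^ (2 * m) %| (h - n) by rewrite pfactor_dvdn ?subn_gt0 // lh; clear -m3; lia.
  by rewrite /f => /dvdnP[k ->]; rewrite mulnC expgM groupX.
(* Now that [e] and [f] lie in both cyclic groups, [C ^ n] is central. Then [A ^ (a ^ n - 1) = 1],
   with valuation m + (2m - 1), one better than [A3]. *)
have CnF : C ^+ n = f * e.
  rewrite CnE hE invMg invgK (cBB e q^-1) ?groupV // mulgA (cBB q f) //.
  by rewrite mulgK.
have CnA : A ^ (C ^+ n) = A.
  apply/conjg_fixP/commgP; rewrite CnF.
  by apply: commuteM; apply: cAA => //; apply: cycle_id.
have CnB' : B ^ (C ^- n) = B.
  apply/conjg_fixP/commgP; rewrite CnF; apply: commuteV.
  by apply: commuteM; apply: cBB => //; apply: cycle_id.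
have A31 : A ^+ (2 ^ (3 * m - 1)) = 1.
  have E : A ^+ (a ^ n).-1 = 1.
    apply: (mulgI A); rewrite mulg1 -expgS prednK ?expn_gt0 ?a0 //.
    by rewrite -ACn.
  by apply: (expg_odd_eq1 A2 _ E); rewrite ?logn_aX ?ln ?predX_gt0 //; clear -m3; lia.
have B31 : B ^+ (2 ^ (3 * m - 1)) = 1.
  have E : B ^+ (b ^ n).-1 = 1.
    apply: (mulgI B); rewrite mulg1 -expgS prednK ?expn_gt0 ?b0 //.
    by rewrite -BCn.
  by apply: (expg_odd_eq1 B2 _ E); rewrite ?logn_bX ?ln ?predX_gt0 //; clear -m3; lia.
have invA : (A ^+ (2 ^ (3 * m - 2))) ^+ 2 = 1.
  by rewrite -expgM -expnSr -A31; congr (_ ^+ (2 ^ _)); clear -m3; lia.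
have invB : (B ^+ (2 ^ (3 * m - 2))) ^+ 2 = 1.
  by rewrite -expgM -expnSr -B31; congr (_ ^+ (2 ^ _)); clear -m3; lia.
have Aodd k := @expg_last_layer _ A _ k A2 invA.
have Bodd k := @expg_last_layer _ B _ k B2 invB.
have tAB : A ^+ (2 ^ (3 * m - 2)) = B ^+ (2 ^ (3 * m - 2)).
  have zA2 : z ^+ (2 ^ (m - 2)) = A ^+ (2 ^ (3 * m - 2)).
    rewrite Ds -expgM Aodd ?muln_gt0 ?s0 ?expn_gt0 //.
    by rewrite lognM ?expn_gt0 // pfactorK // ls; clear -m3; lia.
  have zB2 : (z ^-1) ^+ (2 ^ (m - 2)) = B ^+ (2 ^ (3 * m - 2)).
    rewrite Dt -expgM Bodd ?muln_gt0 ?t0 ?expn_gt0 //.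
    by rewrite lognM ?expn_gt0 // pfactorK // lt; clear -m3; lia.
  rewrite -zB2 expgVn zA2; apply: (mulIg (A ^+ (2 ^ (3 * m - 2)))).
  by rewrite mulVg; exact: invA.
(* Both [f] and [e] equal the common element [A ^ (2 ^ (3 m - 2))], whose square is trivial. *)
have Cn1 : C ^+ n = 1.
  by rewrite CnF /e /f Aodd ?Bodd ?subn_gt0 ?predX_gt0 ?tAB //; exact: invB.
split=> //; first by apply: (expg_odd_eq1 C2 n0 Cn1); rewrite ln.
split=> //.
rewrite -lX expg_odd_in // -/p -(mulKg q p) -DD.
by apply: groupM; rewrite ?groupV; apply: groupX; rewrite mem_gen // inE cycle_id ?orbT.
Qed.

End Upper.

End UpperBound.

(** * Orders and nilpotency class *)

Section OrderAndClass.

Local Open Scope group_scope.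

Lemma ucn_step (gT : finGroupType) (P : {group gT}) (A B x : gT) n :
  P :=: <<[set A; B]>> -> x \in P ->
  [~ x, A] \in 'Z_n(P) -> [~ x, B] \in 'Z_n(P) -> x \in 'Z_n.+1(P).
Proof.
move=> DP xP xA xB.
have nZP : P \subset 'N('Z_n(P)) by apply: normal_norm (ucn_normal _ _).
have [AP BP] : A \in P /\ B \in P by rewrite DP !mem_gen // !inE eqxx ?orbT.
have nZ : {in P, forall y, y \in 'N('Z_n(P))} by apply/subsetP.
have SN : [set A; B] \subset 'N('Z_n(P)) by rewrite subUset !sub1set !nZ.
have xZ : coset 'Z_n(P) x \in 'Z(P / 'Z_n(P)).
  have DQ : P / 'Z_n(P) = <<[set A; B] / 'Z_n(P)>> by rewrite -quotient_gen // -DP.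
  have cZ y : y \in P -> [~ x, y] \in 'Z_n(P) ->
      coset 'Z_n(P) y \in 'C[coset 'Z_n(P) x].
    by move=> yP /coset_id xy; apply/cent1P/commute_sym/commgP; rewrite -morphR ?nZ //= xy.
  rewrite inE mem_quotient //= -sub_cent1 DQ gen_subG.
  by rewrite quotientU !quotient_set1 ?nZ // subUset !sub1set !cZ.
by rewrite ucnSn; apply/morphpreP; split; [apply: nZ | apply: xZ].
Qed.

Section ClassOrder.

Variables (gT : finGroupType) (A B : gT) (a b m : nat).
Hypotheses (rA : A ^ [~ A, B] = A ^+ a) (rB : B ^ [~ B, A] = B ^+ b).
Hypotheses (m3 : (3 <= m)%N) (b0 : (0 < b)%N) (ba : (b < a)%N).
Hypotheses (ua : logn 2 a.-1 = m) (ub : logn 2 b.-1 = m).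
Hypothesis (ud : logn 2 (a - b) = (2 * m - 2)%N).

Let C := [~ A, B].
Let P := <<[set A; B]>>.
Hypothesis P2 : 2.-group P.
Hypothesis P_big : (2 ^ (7 * m - 3) <= #|P|)%N.

(** [<[B]> <*> <[C]>] already contains [A ^ (2 ^ (2 m - 1))], so multiplying by [<[A]>] enlarges it
    by at most that factor. *)
Lemma card_bound : (#|P| <= 2 ^ (2 * m - 1) * (#[B] * #[C]))%N.
Proof.
have [_ _ _ _ [_ _ AH]] := upper_relations rA rB m3 b0 ba ua ub ud P2.
set N := (2 ^ (2 * m - 1))%N; set H := <[B]> <*> <[C]>.
have Pprod : P = H * <[A]> := gen2_prod rA (conj_commg A B).
have cardP := mul_cardG H <[A]>; rewrite -Pprod in cardP.
have leA : (#[A] <= N * #[A ^+ N])%N.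
  apply: dvdn_leq; first by rewrite muln_gt0 expn_gt0 order_gt0.
  by rewrite order_dvdn expgM expg_order.
have leI : (#[A ^+ N] <= #|H :&: <[A]>|)%N.
  by apply: subset_leq_card; rewrite cycle_subG inE AH mem_cycle.
have leH : (#|H| <= #[B] * #[C])%N.
  rewrite /H norm_joinEr ?cycle_subG ?(norm_commg rB) //.
  by have := mul_cardG <[B]> <[C]>; rewrite -/(order B) -/(order C) => ->; rewrite leq_pmulr // cardG_gt0.
have I0 : (0 < #|H :&: <[A]>|)%N := cardG_gt0 _.
rewrite -(leq_pmul2r I0) -cardP mulnAC -/(order A) mulnC.
rewrite leq_mul // (leq_trans leA) // leq_mul2l leI orbT //.
Qed.

(** The lower bound on the order of P leaves no slack in [card_bound], which fixes B and C. For A, a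
    smaller order would kill [A ^ (2 ^ (3 m - 2)) = B ^ (2 ^ (3 m - 2))]. *)
Lemma generator_orders : [/\ #|P| = 2 ^ (7 * m - 3), #[A] = 2 ^ (3 * m - 1),
  #[B] = 2 ^ (3 * m - 1) & #[C] = 2 ^ (2 * m - 1)]%N.
Proof.
have [A1 B1 C1 AB _] := upper_relations rA rB m3 b0 ba ua ub ud P2.
have := leq_trans P_big card_bound.
have /(dvdn_pfactor _ _ (isT : prime 2))[i li oB] : #[B] %| 2 ^ (3 * m - 1) by rewrite order_dvdn B1.
have /(dvdn_pfactor _ _ (isT : prime 2))[j lj oC] : #[C] %| 2 ^ (2 * m - 1) by rewrite order_dvdn C1.
have /(dvdn_pfactor _ _ (isT : prime 2))[k lk oA] : #[A] %| 2 ^ (3 * m - 1) by rewrite order_dvdn A1.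
rewrite oB oC -!expnD leq_exp2l // => le.
have iE : i = (3 * m - 1)%N by clear -m3 le li lj; lia.
have jE : j = (2 * m - 1)%N by clear -m3 le li lj; lia.
have kE : k = (3 * m - 1)%N.
  apply/eqP; rewrite eqn_leq lk leqNgt; apply/negP => lt.
  have : #[B] %| 2 ^ (3 * m - 2).
    by rewrite order_dvdn -AB -order_dvdn oA dvdn_exp2l //; clear -m3 lt; lia.
  by rewrite oB iE dvdn_Pexp2l //; clear -m3; lia.
rewrite oA iE jE kE; split=> //; apply/eqP; rewrite eqn_leq P_big andbT.
apply: leq_trans card_bound _; rewrite oB oC iE jE -!expnD leq_exp2l //.
by clear -m3; lia.
Qed.

Let a0 : (0 < a)%N. Proof. by apply: leq_ltn_trans ba. Qed.
Let a1 := gt1_pred m3 ua. Let b1 := gt1_pred m3 ub.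
Let a4 := dvd4_pred m3 ua. Let b4 := dvd4_pred m3 ub.
Let AP : A \in P. Proof. by rewrite mem_gen // !inE eqxx. Qed.
Let BP : B \in P. Proof. by rewrite mem_gen // !inE eqxx orbT. Qed.
Let CP : C \in P. Proof. by rewrite groupR. Qed.
Let rB' : B ^ C^-1 = B ^+ b. Proof. by rewrite invg_comm. Qed.
Let AB : A ^ B = A * C. Proof. exact: conj_commg. Qed.
Let BA : B ^ A = B * C^-1. Proof. by rewrite invg_comm conj_commg. Qed.

Let commAX k : [~ A, C ^+ k] = A ^+ (a ^ k).-1.
Proof.
rewrite commgEl (conjX_nat _ rA) -{1}(prednK (_ : 0 < a ^ k)%N) ?expn_gt0 ?a0 //.
by rewrite expgS mulKg.
Qed.

Let commBX k : [~ B, C ^- k] = B ^+ (b ^ k).-1.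
Proof.
rewrite commgEl -expgVn (conjX_nat _ rB') -{1}(prednK (_ : 0 < b ^ k)%N) ?expn_gt0 ?b0 //.
by rewrite expgS mulKg.
Qed.

Let le_geo c n : (0 < c)%N -> (n <= c * geo c n)%N.
Proof. by move=> c0; rewrite geo_sgeo // leq_addr. Qed.

Let commAB k : [~ A ^+ k, B] = (C ^+ k) ^ (A ^+ k) * A ^+ (a * geo a k - k).
Proof.
rewrite commgEl (conjXB rA AB) -{1}(subnKC (le_geo k a0)) expgD.
by rewrite conjgE !mulgA.
Qed.

Let commBA k : [~ B ^+ k, A] = (C ^- k) ^ (B ^+ k) * B ^+ (b * geo b k - k).
Proof.
rewrite commgEl (conjXB rB' BA) -{1}(subnKC (le_geo k b0)) expgD expgVn.
by rewrite conjgE !mulgA.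
Qed.

Let in_pow (K : {group gT}) x j n : x ^+ (2 ^ j) \in K -> (0 < n)%N -> (j <= logn 2 n)%N ->
  x ^+ n \in K.
Proof.
move=> xK n0; rewrite -pfactor_dvdn // => /dvdnP[k ->].
by rewrite mulnC expgM groupX.
Qed.

Let log_geo c n : (0 < c)%N -> logn 2 c.-1 = m -> (1 < n)%N -> ~~ odd n ->
  (0 < c * geo c n - n)%N /\ logn 2 (c * geo c n - n) = (m + logn 2 n).-1.
Proof.
move=> c0 uc n1 en; have n0 := ltnW n1.
have c4 := dvd4_pred m3 uc; have c1 := gt1_pred m3 uc.
have u0 : (0 < c.-1)%N by rewrite -subn1 subn_gt0.
rewrite (geo_sgeo _ c0) addKn lognM ?sgeo_gt0 // muln_gt0 u0 sgeo_gt0 //.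
by rewrite uc -(logn_sgeo c0 c4 n0 en) addnS.
Qed.

(** Z_1 contains the 2^(2m)-th powers of A and B, Z_2 their 2^(2m - 1)-th powers and C^(2^m), Z_3
    their 2^m-th powers, Z_4 contains C. Each rung holds because [A^(2^j), B], for j > 0, is a
    conjugate of C^(2^j) times a power of A of valuation m + j - 1, while [A, C^(2^j)] is a power of
    A of valuation m + j; likewise for B. *)
Lemma class_le5 : (nil_class P <= 5)%N.
Proof.
have [A1 B1 C1 _ [AB2 BA2 _]] := upper_relations rA rB m3 b0 ba ua ub ud P2.
have step x n : x \in P -> [~ x, A] \in 'Z_n(P) -> [~ x, B] \in 'Z_n(P) -> x \in 'Z_n.+1(P).
  exact: ucn_step.
have nZ n x y : x \in 'Z_n(P) -> y \in P -> x ^ y \in 'Z_n(P).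
  by move=> xZ yP; rewrite memJ_norm // (subsetP (normal_norm (ucn_normal n P))).
have commC (x y : gT) : [~ y, x] = [~ x, y^-1] ^ y.
  by rewrite /commg /conjg invgK !mulgA mulgKV.
have cZ n x y : commute x y -> [~ x, y] \in 'Z_n(P).
  by move=> /commgP/eqP ->; apply: group1.
have Zc x : x \in <[A]> -> x \in <[B]> -> x \in 'Z_1(P).
  move=> xA xB; have [cA cB _] := comm_cyclesI xA xB.
  by apply: step; [apply: subsetP xA; rewrite cycle_subG | apply: cZ | apply: cZ].
have sub i j : (i <= j)%N -> 'Z_i(P) \subset 'Z_j(P) := @ucn_sub_geq _ _ _ _.
have pw k : (0 < 2 ^ k)%N by rewrite expn_gt0.
have odd2 k : (0 < k)%N -> ~~ odd (2 ^ k) by case: k => // k _; rewrite expnS oddM.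
have gt2 k : (0 < k)%N -> (1 < 2 ^ k)%N by move=> k0; rewrite -{1}(expn0 2) ltn_exp2l.
have m0 : (0 < m)%N by clear -m3; lia.
have m21 : (0 < 2 * m - 1)%N by clear -m3; lia.
have apos c k : (1 < c)%N -> (0 < (c ^ 2 ^ k).-1)%N.
  by move=> c1; rewrite -subn1 subn_gt0 -(expn0 c) ltn_exp2l // pw.
have ZA1 : A ^+ (2 ^ (2 * m)) \in 'Z_1(P) by apply: Zc => //; apply: mem_cycle.
have ZB1 : B ^+ (2 ^ (2 * m)) \in 'Z_1(P) by apply: Zc => //; apply: mem_cycle.
have ZA2 : A ^+ (2 ^ (2 * m - 1)) \in 'Z_2(P).
  apply: step; first exact: groupX.
    exact/cZ/commute_sym/commuteX.
  rewrite commAB C1 conj1g mul1g.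
  have [g0 lg] := @log_geo a (2 ^ (2 * m - 1)) a0 ua (gt2 _ m21) (odd2 _ m21).
  by apply: (in_pow ZA1 g0); rewrite lg pfactorK //; clear -m3; lia.
have ZB2 : B ^+ (2 ^ (2 * m - 1)) \in 'Z_2(P).
  apply: step; first exact: groupX.
    rewrite commBA C1 invg1 conj1g mul1g.
    have [g0 lg] := @log_geo b (2 ^ (2 * m - 1)) b0 ub (gt2 _ m21) (odd2 _ m21).
    by apply: (in_pow ZB1 g0); rewrite lg pfactorK //; clear -m3; lia.
  exact/cZ/commute_sym/commuteX.
have ZC2 : C ^+ (2 ^ m) \in 'Z_2(P).
  apply: step; first exact: groupX.
    rewrite -invg_comm groupV commAX.
    by apply: (in_pow ZA1 (apos _ _ a1)); rewrite (logn_aX m3 ba ua) // pfactorK //; clear -m3; lia.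
  rewrite commC; apply: nZ; last exact: groupX.
  rewrite commBX.
  by apply: (in_pow ZB1 (apos _ _ b1)); rewrite (logn_bX m3 b0 ub) // pfactorK //; clear -m3; lia.
have ZA3 : A ^+ (2 ^ m) \in 'Z_3(P).
  apply: step; first exact: groupX.
    exact/cZ/commute_sym/commuteX.
  rewrite commAB; apply: groupM; first by apply: nZ => //; exact: groupX.
  have [g0 lg] := @log_geo a (2 ^ m) a0 ua (gt2 _ m0) (odd2 _ m0).
  by apply: (in_pow ZA2 g0); rewrite lg pfactorK //; clear -m3; lia.
have ZB3 : B ^+ (2 ^ m) \in 'Z_3(P).
  apply: step; first exact: groupX.
    rewrite commBA; apply: groupM; first by apply: nZ; [rewrite groupV | exact: groupX].
    have [g0 lg] := @log_geo b (2 ^ m) b0 ub (gt2 _ m0) (odd2 _ m0).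
    by apply: (in_pow ZB2 g0); rewrite lg pfactorK //; clear -m3; lia.
  exact/cZ/commute_sym/commuteX.
have ZC4 : C \in 'Z_4(P).
  have AX := commAX 1; have BX := commBX 1; rewrite expn1 expg1 in AX BX.
  apply: (step _ _ CP).
    rewrite -invg_comm groupV AX.
    by apply: (in_pow ZA3); rewrite ?ua // -subn1 subn_gt0.
  rewrite commC; apply: (nZ _ _ _ _ CP).
  rewrite BX.
  by apply: (in_pow ZB3); rewrite ?ub // -subn1 subn_gt0.
have ZA5 : A \in 'Z_5(P) by apply: (step _ _ AP _ ZC4); apply: cZ.
have ZB5 : B \in 'Z_5(P).
  apply: (step _ _ BP); last exact: cZ.
  rewrite -invg_comm groupV; exact: ZC4.
apply/(ucn_nil_classP _ (pgroup_nil P2)); apply/eqP; rewrite eqEsubset ucn_sub.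
by rewrite gen_subG subUset !sub1set ZA5.
Qed.

(** The witness is [[~ w, A]] with [w = [~ A ^ (a - 1), B]]: modulo powers of A, [w] acts on A as
    [C ^ (a - 1)]. If it were trivial, the order of A would divide 2^(2m). *)
Lemma class_ge5 : (5 <= nil_class P)%N.
Proof.
have [_ oA _ _] := generator_orders.
rewrite leqNgt; apply/negP; rewrite ltnS => le4.
have /(lcn_nil_classP _ (pgroup_nil P2)) L5 := le4.
have Lstep n x y : x \in 'L_n.+1(P) -> y \in P -> [~ x, y] \in 'L_n.+2(P).
  by move=> xL yP; rewrite lcnSn; apply: mem_commg.
have L2 : C \in 'L_2(P) by apply: (Lstep 0); rewrite ?lcn1.
have AX := commAX 1; rewrite expn1 expg1 in AX.
have L3 : A ^+ a.-1 \in 'L_3(P).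
  by rewrite -AX -invg_comm groupV; apply: (Lstep 1%N _ _ L2 AP).
set w := [~ A ^+ a.-1, B].
have L4 : w \in 'L_4(P) by apply: (Lstep 2%N _ _ L3 BP).
have := Lstep 3%N _ _ L4 AP.
rewrite L5 inE -invg_comm invg_eq1 commgEl => /eqP wA.
have Aw : A ^ w = A ^+ (a ^ a.-1).
  have cA k : A ^ (A ^+ k) = A by apply/conjg_fixP/commgP/commuteX.
  have cAV k : A ^ (A ^- k) = A by rewrite -{1}(cA k) conjgK.
  by rewrite /w commgEl (conjXB rA AB) !conjgM cAV (conjX_nat _ rA) conjXg cA.
have E : A ^+ (a ^ a.-1).-1 = 1.
  apply: (mulgI A); rewrite mulg1 -expgS prednK ?expn_gt0 ?a0 // -Aw.
  by apply: (mulgI A^-1); rewrite wA mulVg.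
have u0 : (0 < a.-1)%N by rewrite -subn1 subn_gt0.
have : #[A] %| 2 ^ (2 * m).
  rewrite order_dvdn; apply/eqP.
  have A2 : 2.-elt A := mem_p_elt P2 AP.
  apply: (expg_odd_eq1 A2 _ E); first by rewrite -subn1 subn_gt0 -(expn0 a) ltn_exp2l.
  by rewrite (logn_aX m3 ba ua) // ua; clear -m3; lia.
by rewrite oA dvdn_Pexp2l //; clear -m3; lia.
Qed.

End ClassOrder.

End OrderAndClass.

(** * Congruences for geometric sums *)

Section Expansions.

Local Open Scope nat_scope.

Lemma geo_expand p n : exists z, geo p.+1 n = n + p * 'C(n, 2) + p ^ 2 * z.
Proof.
elim: n => [|n [z IH]]; first by exists 0; rewrite geo0 bin0n /= !muln0.
exists (z + 'C(n, 2) + p * z); rewrite geoS IH binS bin1 -addn1; ring.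
Qed.

Lemma sgeo_expand p n :
  exists z, sgeo p.+1 n = 'C(n.+1, 2) + p * 'C(n.+1, 3) + p ^ 2 * z.
Proof.
elim: n => [|n [z IH]]; first by exists 0; rewrite sgeo0 !bin_small // !muln0.
have [y Ey] := geo_expand p n.+1; exists (z + y).
rewrite sgeoS IH Ey [in RHS]binS [in 'C(n.+2, 3)]binS bin1; ring.
Qed.

Lemma expn_expand p n : p.+1 ^ n = 1 + p * geo p.+1 n.
Proof.
have := geo_predn p.+1 n; have : 0 < p.+1 ^ n by rewrite expn_gt0.
by rewrite /=; case: (p.+1 ^ n) => // k _ ->.
Qed.

Lemma bin2_double n : 'C(n.+1, 2) * 2 = n.+1 * n.
Proof. by elim: n => // n IH; rewrite binS bin1 mulnDl IH; ring. Qed.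

Lemma bin3_times6 n : 'C(n.+2, 3) * 6 = n.+2 * n.+1 * n.
Proof.
elim: n => // n IH; rewrite binS mulnDl IH.
by have := bin2_double n.+1; lia.
Qed.

Lemma dvd_bin2_half f n : 4 * f %| n -> 2 * f %| 'C(n, 2).
Proof.
case: n => [|n]; first by rewrite bin0n dvdn0.
case/dvdnP=> k Dk; have := bin2_double n; rewrite Dk => E.
apply/dvdnP; exists (k * n); apply/eqP; rewrite -(@eqn_pmul2r 2) // E; apply/eqP.
ring.
Qed.

Lemma dvd_bin3_half k n : 4 * 2 ^ k %| n -> 2 * 2 ^ k %| 'C(n.+1, 3).
Proof.
case: n => [|n]; first by rewrite dvdn0.
case/dvdnP=> j Dj; have := bin3_times6 n.
rewrite -(@Gauss_dvdr _ 3); last by rewrite -expnS coprimeXl.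
rewrite Dj => E; apply/dvdnP; exists ((j * (4 * 2 ^ k)).+1 * j * n).
apply/eqP; rewrite -(@eqn_pmul2l 2) //; apply/eqP.
by transitivity ('C((j * (4 * 2 ^ k)).+1, 3) * 6); [ring | rewrite E; ring].
Qed.

(** The main term is ['C(N.+1, 2)] with [N = 4 f n]; the cubic term carries [4 f] from the base and
    [2 f] from the binomial coefficient. *)
Lemma sgeo_half k p n : exists z : nat,
  sgeo (4 * 2 ^ k * p).+1 (4 * 2 ^ k * n) = 2 * 2 ^ k * n + 8 * (2 ^ k) ^ 2 * z.
Proof.
set f := 2 ^ k; set N := 4 * f * n.
have [z ->] := sgeo_expand (4 * f * p) N.
have /dvdnP[c3 ->] : 2 * f %| 'C(N.+1, 3) by apply: dvd_bin3_half; rewrite dvdn_mulr.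
have -> : 'C(N.+1, 2) = 2 * f * n + 8 * f ^ 2 * (n ^ 2).
  apply/eqP; rewrite -(@eqn_pmul2r 2) // bin2_double; apply/eqP.
  by rewrite /N; ring.
by exists (n ^ 2 + p * c3 + 2 * p ^ 2 * z); ring.
Qed.

End Expansions.

(** * Iterating the action of B on exponents of A, modulo 32 f^3 *)

Section Congruences.

Local Open Scope nat_scope.

(** The exponent of A in [(A ^ n) ^ B = C ^ n * A ^ (hgeo a n)]. *)
Definition hgeo (a n : nat) : nat := a * geo a n.

Lemma hgeo_sgeo p n : hgeo p.+1 n = n + p * sgeo p.+1 n.
Proof. exact: geo_sgeo. Qed.

Lemma hgeoD a i j : hgeo a (i + j) = hgeo a i + a ^ i * hgeo a j.
Proof. by rewrite /hgeo geoD; ring. Qed.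

Lemma hgeoS a i : hgeo a i.+1 = a * (hgeo a i).+1.
Proof. by rewrite /hgeo geoS. Qed.

(* With [f = 2 ^ (m - 2)] one has [2 ^ m = 4 f], [2 ^ (2 m - 1) = 8 f ^ 2] and
   [2 ^ (3 m - 1) = 32 f ^ 3]; odd numbers are written [w.*2.+1]. *)
Section Numbers.

Variable k : nat.
Let f := 2 ^ k.

Lemma geo_near p n : exists z, geo (4 * f * p).+1 n = n + 4 * f * z.
Proof.
have [z ->] := geo_expand (4 * f * p) n.
by exists (p * 'C(n, 2) + 4 * f * p ^ 2 * z); ring.
Qed.

Lemma expn_near p n : exists z, (4 * f * p).+1 ^ n = 1 + 4 * f * z.
Proof. by exists (p * geo (4 * f * p).+1 n); rewrite expn_expand; ring. Qed.

Lemma hgeo_period u n : exists z,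
  hgeo (4 * f * u.*2.+1).+1 (8 * f ^ 2 * n) = 8 * f ^ 2 * n + 16 * f ^ 3 * n + 32 * f ^ 3 * z.
Proof.
have [z E] := sgeo_half k u.*2.+1 (2 * f * n); rewrite -/f in E.
have -> : 8 * f ^ 2 * n = 4 * f * (2 * f * n) by ring.
by exists (u * n + u.*2.+1 * z); rewrite hgeo_sgeo E -mul2n; ring.
Qed.

Lemma expn_mult p n : 4 * f %| n -> exists z,
  (4 * f * p).+1 ^ n = 1 + 4 * f * p * n + 32 * f ^ 3 * z.
Proof.
move=> /dvd_bin2_half/dvdnP[c Ec]; have [z Ez] := geo_expand (4 * f * p) n.
by exists (p ^ 2 * c + 2 * p ^ 3 * z); rewrite expn_expand Ez Ec; ring.
Qed.

Lemma expn_half v n : exists z,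
  (4 * f * v.*2.+1).+1 ^ (4 * f ^ 2 * n) = 1 + 16 * f ^ 3 * n + 32 * f ^ 3 * z.
Proof.
have [|z ->] := @expn_mult v.*2.+1 (4 * f ^ 2 * n).
  by apply/dvdnP; exists (f * n); ring.
by exists (v * n + z); rewrite -mul2n; ring.
Qed.

Lemma expn_period v n : exists z,
  (4 * f * v.*2.+1).+1 ^ (8 * f ^ 2 * n) = 1 + 32 * f ^ 3 * z.
Proof.
have [z] := expn_half v (2 * n).
have -> : 4 * f ^ 2 * (2 * n) = 8 * f ^ 2 * n by ring.
by move=> ->; exists (n + z); ring.
Qed.

Lemma sgeo_shift u i x : exists z,
  sgeo (4 * f * u).+1 (i + 4 * f * u * x) =
  sgeo (4 * f * u).+1 i + 2 * f * u * i.*2.+1 * x + 8 * f ^ 2 * z.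
Proof.
have [z1 E1] := sgeo_half k u (u * x); rewrite -/f mulnA in E1.
have [z2 E2] := expn_near u i; have [z3 E3] := geo_near u i.
exists (z2 * u * x + z1 * (1 + 4 * f * z2) + 2 * u * x * z3).
by rewrite sgeoD E1 E2 E3 -mul2n; ring.
Qed.

Section Iterate.

Variables (u i : nat).
Let a := (4 * f * u).+1.
Let g := sgeo a i.
Let c := 2 * f * u * i.*2.+1.

(** Write the iterate as [i + 4 f u x_t]. By [sgeo_shift], modulo [8 f ^ 2],
    [x_(t+1) = g + (1 + c) x_t]: an affine recurrence, solved by a geometric sum of ratio [c.+1]. *)
Lemma iter_hgeo t : exists z, iter t (hgeo a) i = i + 4 * f * u * (g * geo c.+1 t + 8 * f ^ 2 * z).
Proof.
elim: t => [|t [z IH]]; first by exists 0; rewrite geo0 /= !muln0 addn0.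
set x := g * _ + _ in IH.
have [y Ey] := sgeo_shift u i x; rewrite -/a -/g -/c in Ey.
exists (z + c * z + y); rewrite iterS IH hgeo_sgeo -/a Ey geoS /x; ring.
Qed.

Lemma iter_hgeo_near t : exists z, iter t (hgeo a) i = i + 4 * f * u * t * g + 8 * f ^ 2 * z.
Proof.
have [z ->] := iter_hgeo t; have [y ->] := geo_expand c t.
exists (u * g * (u * i.*2.+1 * 'C(t, 2) + u * i.*2.+1 * c * y) + 4 * f * u * z).
rewrite /c; ring.
Qed.

End Iterate.

(** Beyond the linear part, the only surviving term is [4 f ^ 2] times a product of odd numbers,
    hence [4 f ^ 2] modulo [8 f ^ 2]. *)
Lemma geo_iterate w j v : exists z,
  geo (2 * f * w.*2.+1 * j.*2.+1).+1 (4 * f * v.*2.+1).+1 =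
  1 + 4 * f * v.*2.+1 + 4 * f ^ 2 + 8 * f ^ 2 * z.
Proof.
set c := 2 * f * w.*2.+1 * j.*2.+1; set N := 4 * f * v.*2.+1.
have [z Ez] := sgeo_expand c N.
have /dvdnP[c3 E3] : 2 * f %| 'C(N.+1, 3) by apply: dvd_bin3_half; rewrite dvdn_mulr.
have E2 : 'C(N.+1, 2) = 2 * f * v.*2.+1 + 8 * f ^ 2 * (v.*2.+1 ^ 2).
  apply/eqP; rewrite -(@eqn_pmul2r 2) // bin2_double; apply/eqP.
  by rewrite /N; ring.
pose d := w.*2.+1 * j.*2.+1.
have [y Ey] : exists y, d * v.*2.+1 = y.*2.+1.
  by exists (d * v.*2.+1)./2; rewrite -[LHS]odd_double_half /d !oddM /= !odd_double.
exists (y + 2 * f * d * v.*2.+1 ^ 2 + f * d ^ 2 * c3 + f * d ^ 3 * z).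
rewrite geoS geo_sgeo // Ez E2 E3.
have -> : c = 2 * f * d by rewrite /c /d; ring.
have Ey' : 4 * f ^ 2 * (d * v.*2.+1) = 4 * f ^ 2 + 8 * f ^ 2 * y by rewrite Ey -mul2n; ring.
rewrite /=.
transitivity (1 + N + (4 * f ^ 2 * (d * v.*2.+1)) + 8 * f ^ 2 * (2 * f * d * v.*2.+1 ^ 2 + f * d ^ 2 * c3 + f * d ^ 3 * z)).
  by rewrite /N; ring.
by rewrite Ey' /N; ring.
Qed.

(* The three coordinates of the relation [C B = B ^ b C] in the model below. *)
Section Relation.

Variables (v l i : nat) (w : nat).
Hypothesis uE : v.*2.+1 + f * l.*2.+1 = w.*2.+1.
Let u := w.*2.+1.
Let v' := v.*2.+1.
Let a := (4 * f * u).+1.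
Let b := (4 * f * v').+1.

Local Open Scope ring_scope.

(** With [g = sgeo a i], the two orders of operation differ modulo 32 f^3 by 8 f^2 u^2 i + 16 f^2
    u^2 i^2 - 16 f^2 u g (u + v' + f). By [uE], u + v' + f = 2u - 2 f l, and 2g is i (i + 1) modulo
    8f; this collapses to -8 f^2 u^2 i. *)
Lemma relation_i : exists z : int,
  (hgeo a (a * i))%:Z = (a * iter b (hgeo a) i)%:Z - 8 * f%:Z ^+ 2 * u%:Z ^+ 2 * i%:Z + 32 * f%:Z ^+ 3 * z.
Proof.
have [z1 E1] := iter_hgeo u i b.
have [z2 E2] := geo_iterate w i v.
rewrite -/u -/v' -/b in E2; rewrite E2 -/a in E1.
set g := sgeo a i in E1.
have [z3 E3] := sgeo_half k u (u * i); rewrite -/f -/a in E3.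
have [z4 E4] := geo_near u i.
have [X Eg] : exists X, (g * 2 = i * i.+1 + 8 * f * X)%N.
  have [z5 E5] := sgeo_expand (4 * f * u) i; rewrite -/a -/g in E5.
  exists (u * 'C(i.+1, 3) + 4 * f * u ^ 2 * z5)%N.
  transitivity ('C(i.+1, 2) * 2 + 8 * f * (u * 'C(i.+1, 3) + 4 * f * u ^ 2 * z5))%N.
    by rewrite E5; ring.
  by rewrite bin2_double; ring.
have Eh : (hgeo a (a * i) = i + 4 * f * u * g + (1 + 4 * f * u * (i + 4 * f * z4)) *
    (4 * f * u * i + 4 * f * u * (2 * f * (u * i) + 8 * f ^ 2 * z3)))%N.
  have -> : (a * i = i + 4 * f * (u * i))%N by rewrite /a; ring.
  rewrite hgeoD expn_expand E4 !hgeo_sgeo E3 -/g; ring.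
have EG : g%:Z * 2 = i%:Z * (i%:Z + 1) + 8 * f%:Z * X%:Z.
  by move/(congr1 Posz): Eg => Eg; rewrite -[LHS]/((g * 2)%N%:Z) Eg; ring.
exists (u%:Z * z3 + u%:Z ^+ 3 * i%:Z ^+ 2 + 4 * f%:Z * u%:Z ^+ 2 * i%:Z * z3 + 2 * u%:Z ^+ 2 * i%:Z * z4
  + 4 * f%:Z * u%:Z ^+ 3 * i%:Z * z4 + 16 * f%:Z ^+ 2 * u%:Z ^+ 2 * z3 * z4 + u%:Z * g%:Z * l%:Z
  - 4 * u%:Z ^+ 2 * X - u%:Z * g%:Z * z2 - u%:Z * z1 - 2 * u%:Z ^+ 2 * g%:Z * v'%:Z
  - 2 * f%:Z * u%:Z ^+ 2 * g%:Z - 4 * f%:Z * u%:Z ^+ 2 * g%:Z * z2 - 4 * f%:Z * u%:Z ^+ 2 * z1).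
rewrite Eh E1; clear E1 E2 E3 E4 Eg Eh; clearbody g.
apply/eqP; rewrite -subr_eq0; apply/eqP.
transitivity (16 * f%:Z ^+ 2 * u%:Z ^+ 2 * (i%:Z * (i%:Z + 1) + 8 * f%:Z * X%:Z - g%:Z * 2)); last first.
  by rewrite EG subrr mulr0.
by rewrite /a /u -uE /v' -!mul2n; ring.
Qed.

Local Open Scope nat_scope.

Lemma sum_iter_near t : exists z, \sum_(s < t) iter s (hgeo a) i =
  t * i + 4 * f * u * 'C(t, 2) * sgeo a i + 8 * f ^ 2 * z.
Proof.
elim: t => [|t [z IH]]; first by exists 0; rewrite big_ord0 !muln0 mul0n.
have [y Ey] := iter_hgeo_near u i t; rewrite -/a in Ey.
exists (z + y); rewrite big_ord_recr /= IH Ey binS bin1; ring.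
Qed.

Lemma relation_k : exists z, \sum_(s < b) iter s (hgeo a) i = b * i + 8 * f ^ 2 * z.
Proof.
have [z ->] := sum_iter_near b; exists (u * v' * b * sgeo a i + z).
have -> : 'C(b, 2) = 2 * f * v' * b.
  by apply/eqP; rewrite -(@eqn_pmul2r 2) // bin2_double; apply/eqP; rewrite /b; ring.
ring.
Qed.

(** In the exponents, multiples of 8 f^2 are periods of [b]; the quadratic terms add up to a
    multiple of 16 f^2 ['C(b, 3)], which vanishes because [2 f] divides ['C(b, 3)]. What remains is
    [geo (b ^ i) b], which exceeds [b] by 8 f^2 v'^2 i modulo 32 f^3. *)
Lemma relation_j k0 : exists z, \sum_(t < b) b ^ (k0 + \sum_(s < t) iter s (hgeo a) i) =
  b ^ k0.+1 + 8 * f ^ 2 * v' ^ 2 * i + 32 * f ^ 3 * z.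
Proof.
set g := sgeo a i.
have term t : exists z, b ^ (\sum_(s < t) iter s (hgeo a) i) =
    (b ^ i) ^ t + 16 * f ^ 2 * u * v' * g * 'C(t, 2) + 32 * f ^ 3 * z.
  have [z ->] := sum_iter_near t; rewrite -/g.
  have [z1 E1] := expn_period v z; rewrite -/v' -/b in E1.
  have [|z2 E2] := @expn_mult v' (4 * f * u * 'C(t, 2) * g).
    by apply/dvdnP; exists (u * 'C(t, 2) * g); ring.
  have [z3 E3] := expn_near v' (i * t); rewrite -/b in E3 E2.
  set q := u * v' * g * 'C(t, 2).
  exists (2 * q * z3 + z2 * (1 + 4 * f * z3) + z1 * (1 + 4 * f * z3) * (1 + 16 * f ^ 2 * q + 32 * f ^ 3 * z2)).
  rewrite !expnD E1 E2 -expnM [t * i]mulnC E3 /q; ring.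
have sum t : exists z, \sum_(s < t) b ^ (\sum_(r < s) iter r (hgeo a) i) =
    geo (b ^ i) t + 16 * f ^ 2 * u * v' * g * 'C(t, 3) + 32 * f ^ 3 * z.
  elim: t => [|t [z IH]]; first by exists 0; rewrite big_ord0 geo0 !muln0.
  have [y Ey] := term t; exists (z + y).
  by rewrite big_ord_recr /= IH Ey geoSr binS; ring.
have [z Ez] := sum b; set N := 4 * f * v'.
have /dvdnP[c3 E3] : 2 * f %| 'C(N.+1, 3) by apply: dvd_bin3_half; rewrite dvdn_mulr.
have [z5 E5] := geo_near v' i; rewrite -/b in E5.
have [z6 E6] := sgeo_half k (v' * geo b i) v'; rewrite -/f mulnA -/N in E6.
have [z7 E7] := expn_near v' k0; rewrite -/b in E7.
have Ed : b ^ i = (N * geo b i).+1 by rewrite /b expn_expand.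
have Eg : geo (b ^ i) b = b + 8 * f ^ 2 * v' ^ 2 * i + 32 * f ^ 3 * (v' ^ 2 * z5 + v' * geo b i * z6).
  by rewrite {2}/b geoS Ed geo_sgeo //= E6 E5 /b /N; ring.
exists (v' ^ 2 * i * z7 + (v' ^ 2 * z5 + v' * geo b i * z6 + u * v' * g * c3 + z) * (1 + 4 * f * z7)).
under eq_bigr => t _ do rewrite expnD.
rewrite -big_distrr /= Ez Eg E3 (expnSr b k0) E7; ring.
Qed.

End Relation.

End Numbers.

End Congruences.

(** * A permutation model *)

Section Model.

Variables (k v l w y2 y3 : nat).
Let f := (2 ^ k)%N.
Let u := w.*2.+1.
Let v' := v.*2.+1.
Let y0 := y2.*2.+1.
Hypothesis uE : (v' + f * l.*2.+1 = u)%N.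
Hypothesis y0E : (y0 * u ^ 2 + v' ^ 2 = 4 * f * y3)%N.

Let a := (4 * f * u).+1.
Let b := (4 * f * v').+1.
Let K := (8 * f ^ 2)%N.
Let M := (32 * f ^ 3)%N.

Let f0 : (0 < f)%N. Proof. by rewrite expn_gt0. Qed.
Let K0 : (0 < K)%N. Proof. by rewrite muln_gt0 expn_gt0 f0. Qed.
Let M0 : (0 < M)%N. Proof. by rewrite muln_gt0 expn_gt0 f0. Qed.

Let point := (nat * nat * nat)%type.

(* A point [(j, n, i)] stands for [B ^ j C ^ n A ^ i].  Points are taken modulo the
   lattice spanned by [(M, 0, 0)], [(0, K, 0)] and [(K * y0, K / 2, - K)]; the
   last vector encodes the relation between [A ^ K], [B ^ K] and [C ^ (K / 2)]. *)
Definition eqv (p p' : point) : Prop :=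
  let: (j, n, i) := p in let: (j', n', i') := p' in
  exists q r s : int, [/\ i%:Z - i'%:Z = 8 * f%:Z ^+ 2 * q,
     j%:Z - j'%:Z + 8 * f%:Z ^+ 2 * y0%:Z * q = 32 * f%:Z ^+ 3 * r &
     n%:Z - n'%:Z + 4 * f%:Z ^+ 2 * q = 8 * f%:Z ^+ 2 * s]%R.

Lemma eqv_sym p p' : eqv p p' -> eqv p' p.
Proof.
case: p p' => [[j n] i] [[j' n'] i'] [q [r [s [E1 E2 E3]]]].
exists (- q)%R, (- r)%R, (- s)%R; split.
- by rewrite mulrN -E1 opprB.
- by rewrite !mulrN -E2; ring.
- by rewrite !mulrN -E3; ring.
Qed.

(** A box of representatives modulo the lattice, with [M * K ^ 2 = 2 ^ (7 m - 3)] elements for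
    [m = k + 2]. *)
Definition cosets : finType := ('I_M * 'I_K * 'I_K)%type.

Definition reduce (p : point) : cosets :=
  let: (j, n, i) := p in
  (Ordinal (ltn_pmod (j + K * y0 * (i %/ K)) M0),
   Ordinal (ltn_pmod (n + 4 * f ^ 2 * (i %/ K)) K0), Ordinal (ltn_pmod i K0)).

Definition coords (x : cosets) : point := let: (j, n, i) := x in (val j, val n, val i).

Lemma reduceK x : reduce (coords x) = x.
Proof.
case: x => [[j n] i]; rewrite /reduce /coords /= divn_small // !muln0 !addn0.
by congr (_, _, _); apply: val_inj; rewrite /= modn_small.
Qed.

Lemma eqv_reduce p : eqv (coords (reduce p)) p.
Proof.
case: p => [[j n] i]; rewrite /reduce /coords /=.
set q := (i %/ K)%N.
have Ei := divn_eq i K; rewrite -/q in Ei.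
have Ej := divn_eq (j + K * y0 * q) M; have En := divn_eq (n + 4 * f ^ 2 * q) K.
exists (- q%:Z)%R, (- ((j + K * y0 * q) %/ M)%N%:Z)%R, (- ((n + 4 * f ^ 2 * q) %/ K)%N%:Z)%R.
move: ((j + K * y0 * q) %/ M)%N ((j + K * y0 * q) %% M)%N Ej => jq j1 Ej.
move: ((n + 4 * f ^ 2 * q) %/ K)%N ((n + 4 * f ^ 2 * q) %% K)%N En => nq n1 En.
clearbody q; move: (i %% K)%N Ei => i1 Ei.
rewrite Ei; split.
- by rewrite /K; ring.
- have -> : (j%:Z = (jq * M + j1)%N%:Z - (K * y0 * q)%N%:Z)%R by rewrite -Ej PoszD; ring.
  by rewrite /K /M; ring.
- have -> : (n%:Z = (nq * K + n1)%N%:Z - (4 * f ^ 2 * q)%N%:Z)%R by rewrite -En PoszD; ring.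
  by rewrite /K; ring.
Qed.

Lemma modn_eq_int (c x y : nat) (z : int) : (0 < c)%N ->
  (x%:Z - y%:Z = c%:Z * z)%R -> (x %% c = y %% c)%N.
Proof.
move=> c0; wlog le : x y z / (y <= x)%N.
  move=> W; have [le|/ltnW le] := leqP y x; first exact: W.
  by move=> E; apply/esym/(W y x (- z)%R) => //; rewrite mulrN -E opprB.
rewrite subzn // => E; apply/eqP; rewrite eqn_mod_dvd //.
have : (c%:Z %| (x - y)%N%:Z)%Z by rewrite E dvdz_mulr.
by rewrite dvdzE.
Qed.

Lemma reduce_eqv p p' : eqv p p' -> reduce p = reduce p'.
Proof.
case: p p' => [[j n] i] [[j' n'] i'] [q [r [s [E1 E2 E3]]]].
have Ei : (i %% K = i' %% K)%N by apply: (@modn_eq_int _ _ _ q) => //; rewrite E1 /K; ring.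
have Eq : ((i %/ K)%N%:Z = (i' %/ K)%N%:Z + q)%R.
  have D1 := divn_eq i K; have D2 := divn_eq i' K; rewrite -Ei in D2.
  have Kz : (K%:Z != 0)%R by rewrite eqz_nat -lt0n.
  apply: (mulfI Kz); rewrite mulrDr.
  have -> : (K%:Z * q = i%:Z - i'%:Z)%R by rewrite E1 /K; ring.
  move: (i %/ K)%N (i' %/ K)%N (i %% K)%N D1 D2 => q1 q2 i1 -> ->.
  by ring.
rewrite /reduce; congr (_, _, _); apply: val_inj => //=.
- apply: (@modn_eq_int _ _ _ r) => //; rewrite !PoszD !PoszM Eq.
  transitivity (32 * f%:Z ^+ 3 * r)%R; last by rewrite /M; ring.
  by rewrite -E2 /K; ring.
- apply: (@modn_eq_int _ _ _ s) => //; rewrite !PoszD !PoszM Eq.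
  transitivity (8 * f%:Z ^+ 2 * s)%R; last by rewrite /K; ring.
  by rewrite -E3; ring.
Qed.

Definition induced (F : point -> point) (x : cosets) : cosets := reduce (F (coords x)).

Definition compatible (F : point -> point) := forall p p', eqv p p' -> eqv (F p) (F p').

Lemma induced_reduce F p : compatible F -> induced F (reduce p) = reduce (F p).
Proof. by move=> cF; apply/reduce_eqv/cF/eqv_reduce. Qed.

Lemma iter_induced_reduce F p t : compatible F -> iter t (induced F) (reduce p) = reduce (iter t F p).
Proof. by move=> cF; elim: t => //= t ->; rewrite induced_reduce. Qed.

(** Such maps are triangular, so a point is recovered from the last coordinate backwards. The
    summands [+ 0] in [mapA] and [mapC] give them literally this shape. *)
Lemma induced_inj (phi psi chi : nat -> nat) :
  (forall i i', chi i = chi i' %[mod K] -> i = i' %[mod K])%N ->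
  injective (induced (fun p => (p.1.1 + phi p.1.2, p.1.2 + psi p.2, chi p.2)%N)).
Proof.
move=> chi_inj [[j n] i] [[j' n'] i']; rewrite /induced /reduce /coords /= => -[Ej En Ei].
have Eii : i = i'.
  by apply: val_inj; have := chi_inj _ _ Ei; rewrite !modn_small.
rewrite -Eii in Ej En *.
have Enn : n = n'.
  apply: val_inj; move/eqP: En; rewrite -!addnA eqn_modDr => /eqP.
  by rewrite !modn_small.
rewrite -Enn in Ej *; congr (_, _, _); apply: val_inj.
by move/eqP: Ej; rewrite -!addnA eqn_modDr => /eqP; rewrite !modn_small.
Qed.

(* Right multiplication by the generators on [B ^ j C ^ n A ^ i]. *)
Definition mapA (p : point) : point := (p.1.1 + 0, p.1.2 + 0, p.2.+1)%N.
Definition mapB (p : point) : point := (p.1.1 + b ^ p.1.2, p.1.2 + p.2, hgeo a p.2)%N.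
Definition mapC (p : point) : point := (p.1.1 + 0, p.1.2 + 1, a * p.2)%N.

Let aK : coprime K a.
Proof.
have -> : K = (2 ^ (3 + k * 2))%N by rewrite /K /f expnD expnM.
by rewrite coprimeXl // coprime2n /a /= !oddM.
Qed.

Lemma mapA_inj : injective (induced mapA).
Proof.
apply: (@induced_inj (fun=> 0%N) (fun=> 0%N) succn) => i i' /eqP.
by rewrite -(addn1 i) -(addn1 i') eqn_modDr => /eqP.
Qed.

Lemma mapC_inj : injective (induced mapC).
Proof.
apply: (@induced_inj (fun=> 0%N) (fun=> 1%N) (muln a)) => i i'.
wlog le : i i' / (i' <= i)%N.
  by move=> W; have [le|/ltnW le] := leqP i' i; [apply: W | move=> /esym/(W _ _ le)].
move/eqP; rewrite eqn_mod_dvd ?leq_mul2l ?le ?orbT // -mulnBr Gauss_dvdr //.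
by rewrite -eqn_mod_dvd // => /eqP.
Qed.

(** [hgeo a (i' + n) - hgeo a i'] is an odd number times [geo a n], which has the same valuation as
    [n]. *)
Lemma mapB_inj : injective (induced mapB).
Proof.
apply: (@induced_inj (expn b) id (hgeo a)) => i i'.
wlog le : i i' / (i' <= i)%N.
  by move=> W; have [le|/ltnW le] := leqP i' i; [apply: W | move=> /esym/(W _ _ le)].
have [n ->] : exists n, i = (i' + n)%N by exists (i - i')%N; rewrite subnKC.
rewrite hgeoD => /eqP; rewrite eqn_mod_dvd ?leq_addr // addKn Gauss_dvdr; last first.
  by rewrite coprimeXr.
rewrite /hgeo Gauss_dvdr //.
have KE : K = (2 ^ (3 + k * 2))%N by rewrite /K /f expnD expnM.
have [->|n0] := posnP n; first by rewrite addn0.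
rewrite KE pfactor_dvdn ?geo_gt0 // logn_geo //; last first.
  by apply/dvdnP; exists (f * u)%N; rewrite /a /=; ring.
rewrite -pfactor_dvdn // -KE => /dvdnP[q ->].
by rewrite addnC modnMDl.
Qed.

Lemma compatA : compatible mapA.
Proof.
move=> [[j n] i] [[j' n'] i'] [q [r [s [E1 E2 E3]]]]; exists q, r, s; split=> /=.
- by rewrite -E1; ring.
- by rewrite -E2; ring.
- by rewrite -E3; ring.
Qed.

Lemma compatC : compatible mapC.
Proof.
move=> [[j n] i] [[j' n'] i'] [q [r [s [E1 E2 E3]]]].
exists (a%:Z * q)%R, (r + y0%:Z * u%:Z * q)%R, (s + 2 * f%:Z * u%:Z * q)%R; split=> /=.
- rewrite mulrCA -E1; ring.
- rewrite mulrDr -E2 /a; ring.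
- rewrite mulrDr -E3 /a; ring.
Qed.

Lemma expn_diff (n n' : nat) (t : int) : (n%:Z - n'%:Z = 4 * f%:Z ^+ 2 * t)%R ->
  exists z : int, ((b ^ n)%N%:Z - (b ^ n')%N%:Z = 16 * f%:Z ^+ 3 * t + 32 * f%:Z ^+ 3 * z)%R.
Proof.
wlog [t' Dt] : n n' t / exists t' : nat, t = t'.
  move=> W; case: t => t E; first by apply: W E; exists t.
  have [|z Ez] := W n' n (t.+1%:Z)%R (ex_intro _ t.+1 erefl).
    by rewrite -opprB E NegzE; ring.
  by exists (- z)%R; rewrite -opprB Ez NegzE; ring.
rewrite Dt => E; have -> : n = (n' + 4 * f ^ 2 * t')%N.
  by apply/eqP; rewrite -eqz_nat; apply/eqP; rewrite -[LHS](subrK (n'%:Z)%R) E; ring.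
have [z1 E1] := expn_half k v t'; rewrite -/f -/v' -/b in E1.
have [z2 E2] := expn_near k v' n'; rewrite -/f -/b in E2.
exists (2 * f%:Z * z2 * t' + (1 + 4 * f%:Z * z2) * z1)%R.
by rewrite expnD E1 E2; ring.
Qed.

(** A shift of [i] by [K q] changes [hgeo a i] by K q (1 + 2f) modulo 32 f^3. This brings 16 f^3 y0
    q into the first coordinate, where [b ^ n] contributes -16 f^3 q; the two cancel modulo 32 f^3
    because [y0] is odd. *)
Lemma compatB : compatible mapB.
Proof.
have main j n i j' n' i' (q : nat) r s :
    (i%:Z - i'%:Z = 8 * f%:Z ^+ 2 * q%:Z)%R ->
    (j%:Z - j'%:Z + 8 * f%:Z ^+ 2 * y0%:Z * q%:Z = 32 * f%:Z ^+ 3 * r)%R ->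
    (n%:Z - n'%:Z + 4 * f%:Z ^+ 2 * q%:Z = 8 * f%:Z ^+ 2 * s)%R ->
  eqv (mapB (j, n, i)) (mapB (j', n', i')).
  move=> E1 E2 E3; have Ei : i = (i' + 8 * f ^ 2 * q)%N.
    by apply/eqP; rewrite -eqz_nat; apply/eqP; rewrite -[LHS](subrK (i'%:Z)%R) E1; ring.
  have [z1 H1] := hgeo_period k w q; rewrite -/f -/u -/a in H1.
  have [z2 H2] := expn_near k u i'; rewrite -/f -/a in H2.
  have [z3 H3] : exists z : int, ((b ^ n)%N%:Z - (b ^ n')%N%:Z =
      16 * f%:Z ^+ 3 * (2 * s - q%:Z) + 32 * f%:Z ^+ 3 * z)%R.
    apply: expn_diff; rewrite -[LHS](addrK (4 * f%:Z ^+ 2 * q%:Z)%R) E3; ring.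
  pose z := (z2 * q + (1 + 4 * f * z2) * z1 + 2 * f * z2 * q)%N.
  have Hh : hgeo a i = (hgeo a i' + 8 * f ^ 2 * q + 16 * f ^ 3 * q + 32 * f ^ 3 * z)%N.
    by rewrite Ei hgeoD H1 H2 /z; ring.
  exists (q%:Z + 2 * f%:Z * q%:Z + 4 * f%:Z * z%:Z)%R,
    (r + y2%:Z * q%:Z + s + y0%:Z * z%:Z + z3)%R,
    (s + q%:Z + f%:Z * q%:Z + 2 * f%:Z * z%:Z)%R; split=> /=.
  - by rewrite Hh; ring.
  - transitivity ((j%:Z - j'%:Z + 8 * f%:Z ^+ 2 * y0%:Z * q%:Z) + ((b ^ n)%N%:Z - (b ^ n')%N%:Z)
      + 8 * f%:Z ^+ 2 * y0%:Z * (2 * f%:Z * q%:Z + 4 * f%:Z * z%:Z))%R; first by ring.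
    by rewrite E2 H3 /y0 -mul2n; ring.
  - transitivity ((n%:Z - n'%:Z + 4 * f%:Z ^+ 2 * q%:Z) + (i%:Z - i'%:Z)
      + 4 * f%:Z ^+ 2 * (2 * f%:Z * q%:Z + 4 * f%:Z * z%:Z))%R; first by ring.
    by rewrite E1 E3; ring.
move=> [[j n] i] [[j' n'] i'] [[q|q] [r [s [E1 E2 E3]]]]; first exact: main E1 E2 E3.
apply: eqv_sym; apply: (main _ _ _ _ _ _ q.+1 (- r)%R (- s)%R).
- by rewrite -opprB E1 NegzE; ring.
- by rewrite mulrN -E2 NegzE; ring.
- by rewrite mulrN -E3 NegzE; ring.
Qed.

Lemma iter_mapB t j n i :
  iter t mapB (j, n, i) = ((j + \sum_(s < t) b ^ (n + \sum_(r < s) iter r (hgeo a) i),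
    n + \sum_(s < t) iter s (hgeo a) i, iter t (hgeo a) i))%N.
Proof.
elim: t => [|t IH]; first by rewrite !big_ord0 !addn0.
by rewrite iterS IH /mapB /= !big_ord_recr /= !addnA.
Qed.

(** By [relation_i] the last coordinates differ by -K u^2 i modulo M, so the skew lattice vector is
    needed with q = -u^2 i modulo 4f. The first coordinate then requires y0 u^2 + v'^2 to vanish
    modulo M / K = 4f, which is [y0E]. In the second, (a - b) i = 4 f^2 (2l + 1) i is compensated by
    (K/2) q, since u is odd. *)
Lemma eqv_relB p : eqv (mapB (mapC p)) (mapC (iter b mapB p)).
Proof.
case: p => [[j n] i]; rewrite iter_mapB /mapB /mapC /=.
have [z1 E1] := @relation_i k v l i w uE; rewrite -/f -/u -/v' -/a -/b in E1.
have [z2 E2] := @relation_k k v i w; rewrite -/f -/u -/v' -/a -/b in E2.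
have [z3 E3] := @relation_j k v i w n; rewrite -/f -/u -/v' -/a -/b in E3.
rewrite E2 E3 E1.
exists (- (u%:Z ^+ 2 * i%:Z) + 4 * f%:Z * z1)%R,
  (- (y3%:Z * i%:Z) + y0%:Z * z1 - z3%:Z)%R,
  (i%:Z * (l%:Z - 2 * w%:Z ^+ 2 - 2 * w%:Z) + 2 * f%:Z * z1 - z2%:Z)%R; split.
- ring.
- have EY : (y0%:Z * u%:Z ^+ 2 + v'%:Z ^+ 2 = 4 * f%:Z * y3%:Z)%R.
    transitivity ((y0 * u ^ 2 + v' ^ 2)%N%:Z)%R; first by ring.
    by rewrite y0E; ring.
  rewrite addn1; transitivity (- (8 * f%:Z ^+ 2 * i%:Z * (y0%:Z * u%:Z ^+ 2 + v'%:Z ^+ 2))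
    + 32 * f%:Z ^+ 3 * (y0%:Z * z1 - z3%:Z))%R; first by ring.
  by rewrite EY; ring.
- have EU : (u%:Z - v'%:Z = f%:Z * (2 * l%:Z + 1))%R by rewrite -uE -mul2n; ring.
  transitivity (4 * f%:Z * i%:Z * (u%:Z - v'%:Z)
    + 4 * f%:Z ^+ 2 * (- (u%:Z ^+ 2 * i%:Z) + 4 * f%:Z * z1) - 8 * f%:Z ^+ 2 * z2%:Z)%R.
    by rewrite /a /b; ring.
  by rewrite EU /u -mul2n; ring.
Qed.

Let pA := perm mapA_inj.
Let pB := perm mapB_inj.
Let pC := perm mapC_inj.

Lemma perm_reduceX F (F_inj : injective (induced F)) t p : compatible F ->
  (perm F_inj ^+ t)%g (reduce p) = reduce (iter t F p).
Proof.
move=> cF; rewrite permX -iter_induced_reduce //.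
by elim: t => //= t ->; rewrite permE.
Qed.

Lemma perm_reduce F (F_inj : injective (induced F)) p : compatible F ->
  perm F_inj (reduce p) = reduce (F p).
Proof. by move=> cF; rewrite permE induced_reduce. Qed.

Lemma perm_commAB : [~ pA, pB]%g = pC.
Proof.
apply: (mulgI (pB * pA))%g; rewrite -commgC; apply/permP => x.
rewrite !permM -(reduceK x) !perm_reduce ?induced_reduce //; do ?[exact: compatA|exact: compatB|exact: compatC].
apply: (congr1 reduce); case: (coords x) => [[j n] i].
by rewrite /mapA /mapB /mapC /= hgeoS !addn0 addn1 addnS.
Qed.

Lemma perm_relA : (pA ^ pC = pA ^+ a)%g.
Proof.
apply: (mulgI pC); rewrite -conjgC; apply/permP => x.
rewrite !permM -(reduceK x) perm_reduce; last exact: compatA.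
rewrite !perm_reduce ?perm_reduceX; do ?[exact: compatA|exact: compatB|exact: compatC].
have itA t p : iter t mapA p = (p.1.1, p.1.2, p.2 + t)%N.
  elim: t => [|t IH]; first by rewrite addn0; case: p => [[]].
  by rewrite iterS IH /mapA /= !addn0 addnS.
by apply: (congr1 reduce); rewrite itA /mapA /mapC /= !addn0 mulnS [(a + _)%N]addnC.
Qed.

Lemma perm_relB : (pB ^ pC^-1 = pB ^+ b)%g.
Proof.
apply: (mulIg pC); rewrite conjgE invgK mulgA mulgKV; apply/permP => x.
rewrite !permM -(reduceK x) perm_reduce; last exact: compatC.
rewrite perm_reduceX; last exact: compatB.
rewrite !perm_reduce; do ?[exact: compatA|exact: compatB|exact: compatC].
exact/reduce_eqv/eqv_relB.
Qed.

Lemma perm_card : #|cosets| %| #|<<[set pA; pB]>>%g|.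
Proof.
set G := <<_>>%g.
have [AG BG] : pA \in G /\ pB \in G by rewrite !mem_gen // !inE eqxx ?orbT.
have CG : pC \in G by rewrite -perm_commAB groupR.
have orbE : orbit 'P%act G (reduce (0, 0, 0)%N) = [set: cosets].
  apply/setP => x; rewrite inE; apply/orbitP.
  case Ex : (coords x) => [[j n] i].
  exists (pB ^+ j * pC ^+ n * pA ^+ i)%g; first by rewrite !groupM ?groupX.
  change ((pB ^+ j * pC ^+ n * pA ^+ i)%g (reduce (0, 0, 0)%N) = x).
  have itB t : iter t mapB (0, 0, 0)%N = (t, 0, 0)%N.
    by elim: t => // t IH; rewrite iterS IH /mapB /= addn1 /hgeo geo0 muln0.
  have itC t : iter t mapC (j, 0, 0)%N = (j, t, 0)%N.
    by elim: t => // t IH; rewrite iterS IH /mapC /= addn0 addn1 muln0.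
  have itA t : iter t mapA (j, n, 0)%N = (j, n, t)%N.
    by elim: t => // t IH; rewrite iterS IH /mapA /= !addn0.
  rewrite !permM perm_reduceX; last exact: compatB.
  rewrite itB perm_reduceX ?itC; last exact: compatC.
  by rewrite perm_reduceX ?itA -?Ex ?reduceK //; apply: compatA.
by rewrite -cardsT -orbE dvdn_orbit.
Qed.

End Model.

(** * Integer exponents *)

Section Assembly.

Local Open Scope group_scope.

Lemma card_cosets k : #|cosets k| = (2 ^ (7 * k + 11))%N.
Proof.
rewrite !card_prod !card_ord -expnM.
rewrite (_ : 32 = 2 ^ 5)%N // (_ : 8 = 2 ^ 3)%N // -!expnM -!expnD.
by congr (2 ^ _)%N; lia.
Qed.

Lemma solve_lattice_vector k w v : exists y2 y3,
  (y2.*2.+1 * w.*2.+1 ^ 2 + v.*2.+1 ^ 2 = 4 * 2 ^ k * y3)%N.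
Proof.
set N := (4 * 2 ^ k)%N; set d := (w.*2.+1 ^ 2)%N.
have NE : N = (2 ^ k.+2)%N by rewrite /N !expnS mulnA.
have N0 : (0 < N)%N by rewrite NE expn_gt0.
have t0 : (0 < totient N)%N by rewrite totient_gt0.
(* [y] is [- v' ^ 2 / d] modulo [N], with [N.-1] for -1 and Euler's theorem for the inverse of [d];
   all its factors are odd. *)
set y := (N.-1 * v.*2.+1 ^ 2 * d ^ (totient N).-1)%N.
have oy : odd y.
  rewrite /y /d !oddM !oddX /= !odd_double /= !orbT !andbT.
  by rewrite -subn1 oddB // NE oddX.
have cop : coprime d N by rewrite NE coprimeXr // coprimen2 /d oddX /= odd_double.
have : N %| y * d + v.*2.+1 ^ 2.
  have -> : (y * d = N.-1 * v.*2.+1 ^ 2 * d ^ totient N)%N.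
    by rewrite /y -[in RHS](prednK t0) (expnSr d) !mulnA.
  have /eqP := Euler_exp_totient cop; rewrite eqn_mod_dvd ?expn_gt0 // => /dvdnP[q Dq].
  have -> : (d ^ totient N = 1 + q * N)%N.
    by rewrite -Dq subnKC // expn_gt0.
  apply/dvdnP; exists (v.*2.+1 ^ 2 * (1 + N.-1 * q))%N.
  by move: N.-1 (prednK N0) => n1 <-; ring.
case/dvdnP => y3 E; exists y./2, y3.
by rewrite [RHS]mulnC -E; congr (_ * _ + _)%N; rewrite -[RHS]odd_double_half oy.
Qed.

Lemma model_exists k v l w : (v.*2.+1 + 2 ^ k * l.*2.+1 = w.*2.+1)%N ->
  exists x y : {perm cosets k},
  [/\ x ^ [~ x, y] = x ^+ (4 * 2 ^ k * w.*2.+1).+1,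
      y ^ [~ y, x] = y ^+ (4 * 2 ^ k * v.*2.+1).+1 &
      2 ^ (7 * k + 11) %| #|<<[set x; y]>>|].
Proof.
move=> uE; have [y2 [y3 yE]] := solve_lattice_vector k w v.
exists (perm (@mapA_inj k y2)), (perm (@mapB_inj k v w y2)); split.
- by rewrite perm_commAB perm_relA.
- by rewrite -invg_comm perm_commAB (perm_relB uE yE).
- by rewrite -card_cosets perm_card.
Qed.

Lemma zexpg_mod (hT : finGroupType) (x : hT) (z : int) (n : nat) :
  (#[x]%:Z %| (z - n%:Z)%R)%Z -> zexpg x z = x ^+ n.
Proof.
rewrite dvdzE /dvdn /= => /eqP.
case: z => p /=.
  have [le|/ltnW le] := leqP p n.
    rewrite -abszN opprB subzn // => E; apply/esym/eqP.
    by rewrite eq_expg_mod_order eqn_mod_dvd // /dvdn E.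
  rewrite subzn // => E; apply/eqP.
  by rewrite eq_expg_mod_order eqn_mod_dvd // /dvdn E.
rewrite NegzE -opprD abszN -PoszD absz_nat => E.
apply: (mulgI (x ^+ p.+1)); rewrite mulgV -expgD; apply/esym/eqP.
by rewrite -order_dvdn /dvdn E.
Qed.

Lemma v2_mod (z : int) (n N : nat) : z != 0%R -> (v2 z < N)%N ->
  ((2 ^ N)%N%:Z %| (z - n%:Z)%R)%Z -> logn 2 n = v2 z.
Proof.
move=> z0 ltN dv; rewrite /v2.
have z0' : (0 < `|z|)%N by rewrite absz_gt0.
have eqd j : (j <= N)%N -> (2 ^ j %| n) = (2 ^ j %| `|z|)%N.
  move=> jN; have dj : ((2 ^ j)%N%:Z %| (z - n%:Z)%R)%Z.
    by apply: dvdz_trans dv; rewrite dvdzE /= dvdn_exp2l.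
  have /eqP E : (z == n%:Z %[mod (2 ^ j)%N%:Z])%Z by rewrite eqz_mod_dvd.
  transitivity ((2 ^ j)%N%:Z %| n%:Z)%Z; first by rewrite dvdzE.
  transitivity ((2 ^ j)%N%:Z %| z)%Z; last by rewrite dvdzE.
  by apply/dvdz_mod0P/dvdz_mod0P; rewrite E.
have n0 : (0 < n)%N.
  rewrite lt0n; apply/eqP => n0; move: (eqd N (leqnn N)); rewrite n0 dvdn0 => /esym.
  by rewrite pfactor_dvdn // leqNgt ltN.
apply/eqP; rewrite eqn_leq; apply/andP; split.
  by rewrite leqNgt -pfactor_dvdn // eqd // pfactor_dvdn // ltnn.
by rewrite -pfactor_dvdn // eqd ?pfactor_dvdn //; apply: ltnW.
Qed.

Lemma odd_part n j : (0 < n)%N -> logn 2 n = j -> exists q, n = (2 ^ j * q.*2.+1)%N.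
Proof.
move=> n0 <-; have [q oq Dn] := pfactor_coprime (isT : prime 2) n0.
rewrite coprime2n in oq; exists q./2; rewrite {1}Dn mulnC; congr (_ * _)%N.
by rewrite -[LHS]odd_double_half oq.
Qed.

Section Final.

Variables (alpha beta : int) (m : nat).
Hypotheses (alpha1 : alpha != 1%R) (beta1 : beta != 1%R).
Hypotheses (va : v2 (alpha - 1)%R = m) (vb : v2 (beta - 1)%R = m) (m3 : (3 <= m)%N).
Hypothesis vab : v2 (alpha - beta)%R = (2 * m - 2)%N.

Lemma nat_exponents R : (0 < R)%N -> 2 ^ (3 * m) %| R -> exists a b : nat,
  [/\ (0 < b < a)%N, logn 2 a.-1 = m, logn 2 b.-1 = m, logn 2 (a - b) = (2 * m - 2)%N &
      (R%:Z %| (alpha - a%:Z)%R)%Z /\ (R%:Z %| (beta - b%:Z)%R)%Z].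
Proof.
move=> R0 R2; have Rz : (R%:Z != 0)%R by rewrite eqz_nat -lt0n.
pose r (z : int) := absz (z %% R%:Z)%Z.
have rE z : ((r z)%:Z = (z %% R%:Z)%Z)%R by rewrite /r gez0_abs // modz_ge0.
have rR z : (r z < R)%N by rewrite -ltz_nat rE ltz_pmod.
have rd z c : (R%:Z %| (z - (r z + c * R)%N%:Z)%R)%Z.
  rewrite PoszD rE {1}(divz_eq z R%:Z) opprD addrA addrK PoszM -mulrBl.
  by rewrite dvdz_mull.
have dv2 (z : int) : (R%:Z %| z)%Z -> ((2 ^ (3 * m))%N%:Z %| z)%Z.
  by apply: dvdz_trans; rewrite dvdzE.
have predE n : (0 < n)%N -> (n.-1%:Z = n%:Z - 1)%R by case: n => // n _ /=; ring.
(* Residues are below [R], so adding [2 R] and [R] forces [0 < b < a] whatever the order of [alpha]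
   and [beta]. *)
pose a := (r alpha + 2 * R)%N; pose b := (r beta + 1 * R)%N.
have a0 : (0 < a)%N by rewrite addn_gt0 muln_gt0 R0 orbT.
have b0 : (0 < b)%N by rewrite addn_gt0 muln_gt0 R0 orbT.
have ba : (b < a)%N by rewrite /a /b; have := rR beta; clear -R0; lia.
have m0 : (m < 3 * m)%N by clear -m3; lia.
exists a, b; split=> //; try by split; apply: rd.
- by rewrite b0.
- rewrite -va; apply: (@v2_mod _ _ (3 * m)); rewrite ?subr_eq0 ?va //.
  by rewrite predE // opprB addrA subrK; apply/dv2/rd.
- rewrite -vb; apply: (@v2_mod _ _ (3 * m)); rewrite ?subr_eq0 ?vb //.
  by rewrite predE // opprB addrA subrK; apply/dv2/rd.
- rewrite -vab; apply: (@v2_mod _ _ (3 * m)).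
  + apply/eqP => E; move: vab; rewrite E /v2 absz0 logn0; clear -m3; lia.
  + by rewrite vab; clear -m3; lia.
  + have -> : (alpha - beta - (a - b)%N%:Z = (alpha - a%:Z) - (beta - b%:Z))%R.
      by rewrite -subzn ?(ltnW ba) //; ring.
    by apply: rpredB; apply/dv2/rd.
Qed.

End Final.

End Assembly.

(** * Transfer to the presented group *)

Local Open Scope group_scope.

Theorem theorem16p2 (alpha beta : int) (m : nat)
  (gT : finGroupType) (G : {group gT}) (A B : gT) :
  alpha != 1%R -> beta != 1%R ->
  v2 (alpha - 1)%R = m -> v2 (beta - 1)%R = m -> (3 <= m)%N ->
  v2 (alpha - beta)%R = (2 * m - 2)%N ->
  presents_G alpha beta G A B ->
  forall G2 : {group gT}, (G2 \in 'Syl_2(G)%g) ->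
    [/\ #|G2| = (2 ^ (7 * m - 3))%N,
        nil_class G2 = 5%N,
        #[(A.`_2)%g]%g = (2 ^ (3 * m - 1))%N,
        #[(B.`_2)%g]%g = (2 ^ (3 * m - 1))%N &
        #[(([~ A, B]%g).`_2)%g]%g = (2 ^ (2 * m - 1))%N].
Proof.
move=> alpha1 beta1 va vb m3 vab [DG [rA rB] univ] G2; rewrite inE => sylG2.
pose k := (m - 2)%N; have mk : m = k.+2 by rewrite /k; clear -m3; lia.
(* One modulus for everything: it annihilates G and the permutation group, and its factor 2^(3m)
   preserves the three valuations. *)
pose R := (#|G| * #|[set: {perm cosets k}]| * 2 ^ (3 * m))%N.
have R0 : (0 < R)%N by rewrite !muln_gt0 !cardG_gt0 expn_gt0.
have [a [b [/andP[b0 ba] ua ub uab [da db]]]] :=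
  nat_exponents alpha1 beta1 va vb m3 vab R0 (dvdn_mull _ (dvdnn _)).
have expR (hT : finGroupType) (x : hT) z n : #[x] %| R -> (R%:Z %| (z - n%:Z)%R)%Z ->
    zexpg x z = x ^+ n.
  by move=> xR; move/(dvdz_trans _) => dz; apply/zexpg_mod/dz; rewrite dvdzE.
have AG : A \in G by rewrite DG mem_gen // !inE eqxx.
have BG : B \in G by rewrite DG mem_gen // !inE eqxx orbT.
have GR x : x \in G -> #[x] %| R by move=> xG; rewrite !dvdn_mulr // order_dvdG.
rewrite (expR _ _ _ a (GR _ AG) da) in rA; rewrite (expR _ _ _ b (GR _ BG) db) in rB.
have a0 : (0 < a)%N by apply: leq_ltn_trans ba.
have [nP sylP] := parts_Hall 2 a0 b0 rA rB.
have [rA2 rB2] := parts_rel 2 a0 b0 rA rB.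
have C2 := parts_comm 2 a0 b0 rA rB.
set P := <<[set A.`_2; B.`_2]>>%G in nP sylP.
rewrite -DG in nP sylP.
have G2P : G2 :=: P.
  have [g gG ->] := Sylow_trans sylP sylG2.
  by have /normalP[_ ->] := nP.
have pred0 c : logn 2 c.-1 = m -> (0 < c.-1)%N.
  by move=> uc; rewrite lt0n; apply/eqP => c0; move: uc m3; rewrite c0 logn0 => <-.
have [w Dw] : exists w, a.-1 = (2 ^ m * w.*2.+1)%N by apply: odd_part => //; apply: pred0.
have [v Dv] : exists w, b.-1 = (2 ^ m * w.*2.+1)%N by apply: odd_part => //; apply: pred0.
have [l Dl] : exists w, (a - b)%N = (2 ^ (2 * m - 2) * w.*2.+1)%N by apply: odd_part; rewrite // subn_gt0.
have f4 : (4 * 2 ^ k = 2 ^ m)%N by rewrite mk !expnS mulnA.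
have uE : (v.*2.+1 + 2 ^ k * l.*2.+1 = w.*2.+1)%N.
  apply/eqP; rewrite -(@eqn_pmul2l (2 ^ m)) ?expn_gt0 // mulnDr -Dv -Dw mulnA -expnD.
  have -> : (m + k = 2 * m - 2)%N by rewrite mk; clear; lia.
  by rewrite -Dl; clear -a0 b0 ba; lia.
have [x [y [rx ry card]]] := model_exists uE.
have aE : (4 * 2 ^ k * w.*2.+1).+1 = a by rewrite f4 -Dw prednK.
have bE : (4 * 2 ^ k * v.*2.+1).+1 = b by rewrite f4 -Dv prednK.
rewrite aE in rx; rewrite bE in ry.
have HR (z : {perm cosets k}) : #[z] %| R.
  by rewrite /R -mulnA dvdn_mull // dvdn_mulr // order_dvdG ?inE.
have [f [fA fB]] : exists f : {morphism G >-> {perm cosets k}}, f A = x /\ f B = y.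
  by apply: univ; split; rewrite ?(expR _ _ _ a (HR _) da) ?(expR _ _ _ b (HR _) db).
have bigP : (2 ^ (7 * m - 3) <= #|P|)%N.
  have : 2 ^ (7 * m - 3) %| #|G|.
    have -> : (7 * m - 3 = 7 * k + 11)%N by rewrite mk; clear; lia.
    apply: dvdn_trans card _; apply: dvdn_trans (dvdn_morphim f G).
    by apply: cardSg; rewrite gen_subG subUset !sub1set -fA -fB !mem_morphim.
  rewrite (card_Hall sylP) p_part pfactor_dvdn // leq_exp2l //.
have [_ P2 _] := and3P sylP.
have [cP oA oB oC] := generator_orders rA2 rB2 m3 b0 ba ua ub uab P2 bigP.
rewrite C2 in oC; rewrite G2P; split=> //; apply/eqP; rewrite eqn_leq.
rewrite (class_le5 rA2 rB2 m3 b0 ba ua ub uab P2).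
exact: class_ge5 rA2 rB2 m3 b0 ba ua ub uab P2 bigP.
Qed.
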